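(* Let $k\ge0$ be an integer and $a,b\in\mathbb{C}$ generic. Put $u=\tfrac34-\tfrac k2-\tfrac a2+\tfrac b2$, $v=\tfrac34-\tfrac k2-\tfrac a2-\tfrac b2$ (assume $(u)_k(v)_k\ne0$), and define the polynomial of degree $2k$ in $n$ $$Q_k^{(3')}(n;a;b)=\frac{1}{(u)_k(v)_k}\sum_{j=0}^{k}\frac{(-\tfrac n2)_j(-\tfrac n2+\tfrac12)_j(-k)_j}{j!}\,(u-n+j)_{k-j}(v-n+j)_{k-j},$$ i.e. $\frac{(u-n)_k(v-n)_k}{(u)_k(v)_k}\,{}_3F_2\!\left[\begin{smallmatrix}-\frac n2,\ -\frac n2+\frac12,\ -k\\ u-n,\ v-n\end{smallmatrix}\big|1\right]$. Then, near $x=0$, $${}_3F_2\!\left[\begin{matrix}\tfrac a3,\ \tfrac13+\tfrac a3,\ \tfrac23+\tfrac a3\\ \tfrac34+\tfrac k2+\tfrac a2+\tfrac b2,\ \tfrac34+\tfrac k2+\tfrac a2-\tfrac b2\end{matrix}\,\Big|\,\frac{27x^2}{(4-x)^3}\right]=\Bigl(1-\tfrac x4\Bigr)^a\sum_{n=0}^\infty\frac{(a)_n(\tfrac14-\tfrac k2+\tfrac a2-\tfrac b2)_n(\tfrac14-\tfrac k2+\tfrac a2+\tfrac b2)_n}{n!\,(\tfrac12+k+a+b)_n(\tfrac12+k+a-b)_n}\,Q_k^{(3')}(n;a;b)\,x^n.$$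
   Context: $(c)_n$ denotes the Pochhammer symbol, $(c)_0=1$; ${}_pF_q$ is the generalized hypergeometric series. Parameters are assumed such that no lower parameter is a nonpositive integer. *)

(* Defs.v *)
From Stdlib Require Import Reals Lra Lia Arith Factorial.
Open Scope R_scope.

Definition Cplx : Type := (R * R)%type.
Definition Cre (z : Cplx) : R := fst z.
Definition Cim (z : Cplx) : R := snd z.
Definition RtoC (r : R) : Cplx := (r, 0).
Definition NtoC (n : nat) : Cplx := RtoC (INR n).
Definition Czero : Cplx := RtoC 0.
Definition Cone : Cplx := RtoC 1.
Definition Cadd (z w : Cplx) : Cplx := (Cre z + Cre w, Cim z + Cim w).
Definition Copp (z : Cplx) : Cplx := (- Cre z, - Cim z).
Definition Csub (z w : Cplx) : Cplx := Cadd z (Copp w).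
Definition Cmul (z w : Cplx) : Cplx :=
  (Cre z * Cre w - Cim z * Cim w, Cre z * Cim w + Cim z * Cre w).
Definition Cnorm2 (z : Cplx) : R := Cre z * Cre z + Cim z * Cim z.
Definition Cnorm (z : Cplx) : R := sqrt (Cnorm2 z).
Definition Cinv (z : Cplx) : Cplx := (Cre z / Cnorm2 z, - Cim z / Cnorm2 z).
Definition Cdiv (z w : Cplx) : Cplx := Cmul z (Cinv w).
Fixpoint Cpown (z : Cplx) (n : nat) : Cplx :=
  match n with O => Cone | S m => Cmul (Cpown z m) z end.

(** Complex exponential, principal argument (in (-PI, PI]) and logarithm,
    and the principal-branch complex power z^w = exp (w * Log z). *)
Definition Cexp (z : Cplx) : Cplx := (exp (Cre z) * cos (Cim z), exp (Cre z) * sin (Cim z)).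
Definition Carg (z : Cplx) : R :=
  let x := Cre z in let y := Cim z in
  if Rlt_dec 0 x then atan (y / x)
  else if Rlt_dec x 0 then
         (if Rle_dec 0 y then atan (y / x) + PI else atan (y / x) - PI)
  else if Rlt_dec 0 y then PI / 2
  else if Rlt_dec y 0 then - (PI / 2) else 0.
Definition Cln (z : Cplx) : Cplx := (ln (Cnorm z), Carg z).
Definition Cpow (z w : Cplx) : Cplx := Cexp (Cmul w (Cln z)).

Fixpoint poch (c : Cplx) (n : nat) : Cplx :=
  match n with O => Cone | S m => Cmul (poch c m) (Cadd c (NtoC m)) end.

Fixpoint Csum (f : nat -> Cplx) (n : nat) : Cplx :=
  match n with O => f O | S m => Cadd (Csum f m) (f (S m)) end.

(** Convergence of the complex series sum_{n>=0} f n to l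
    (componentwise convergence of partial sums = convergence in C). *)
Definition Cseries_to (f : nat -> Cplx) (l : Cplx) : Prop :=
  Un_cv (fun N => Cre (Csum f N)) (Cre l) /\ Un_cv (fun N => Cim (Csum f N)) (Cim l).

Definition not_nonpos_int (c : Cplx) : Prop := forall m : nat, c <> Copp (NtoC m).

Definition F32_term (a1 a2 a3 b1 b2 z : Cplx) (m : nat) : Cplx :=
  Cdiv (Cmul (Cmul (Cmul (poch a1 m) (poch a2 m)) (poch a3 m)) (Cpown z m))
       (Cmul (Cmul (NtoC (fact m)) (poch b1 m)) (poch b2 m)).

Definition half : Cplx := RtoC (1/2).
Definition Cu (k : nat) (a b : Cplx) : Cplx :=
  Cadd (Csub (Csub (RtoC (3/4)) (Cmul half (NtoC k))) (Cmul half a)) (Cmul half b).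
Definition Cv (k : nat) (a b : Cplx) : Cplx :=
  Csub (Csub (Csub (RtoC (3/4)) (Cmul half (NtoC k))) (Cmul half a)) (Cmul half b).

Definition Q3 (k : nat) (a b : Cplx) (n : nat) : Cplx :=
  let u := Cu k a b in let v := Cv k a b in
  let hn := Cmul half (NtoC n) in
  Cdiv
    (Csum (fun j =>
       Cmul
         (Cdiv (Cmul (Cmul (poch (Copp hn) j) (poch (Cadd (Copp hn) half) j))
                     (poch (Copp (NtoC k)) j))
               (NtoC (fact j)))
         (Cmul (poch (Cadd (Csub u (NtoC n)) (NtoC j)) (k - j))
               (poch (Cadd (Csub v (NtoC n)) (NtoC j)) (k - j)))) k)
    (Cmul (poch u k) (poch v k)).

Definition Lb1 (k : nat) (a b : Cplx) : Cplx :=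
  Cadd (Cadd (Cadd (RtoC (3/4)) (Cmul half (NtoC k))) (Cmul half a)) (Cmul half b).
Definition Lb2 (k : nat) (a b : Cplx) : Cplx :=
  Csub (Cadd (Cadd (RtoC (3/4)) (Cmul half (NtoC k))) (Cmul half a)) (Cmul half b).

Definition Rc1 (k : nat) (a b : Cplx) : Cplx := Cadd (Cadd (Cadd half (NtoC k)) a) b.
Definition Rc2 (k : nat) (a b : Cplx) : Cplx := Csub (Cadd (Cadd half (NtoC k)) a) b.

Definition third : Cplx := RtoC (1/3).
Definition LHS_term (k : nat) (a b x : Cplx) (m : nat) : Cplx :=
  F32_term (Cmul third a) (Cadd third (Cmul third a))
           (Cadd (RtoC (2/3)) (Cmul third a))
           (Lb1 k a b) (Lb2 k a b)
           (Cdiv (Cmul (RtoC 27) (Cmul x x)) (Cpown (Csub (RtoC 4) x) 3)) m.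

Definition Rp1 (k : nat) (a b : Cplx) : Cplx :=
  Csub (Cadd (Csub (RtoC (1/4)) (Cmul half (NtoC k))) (Cmul half a)) (Cmul half b).
Definition Rp2 (k : nat) (a b : Cplx) : Cplx :=
  Cadd (Cadd (Csub (RtoC (1/4)) (Cmul half (NtoC k))) (Cmul half a)) (Cmul half b).
Definition RHS_term (k : nat) (a b x : Cplx) (n : nat) : Cplx :=
  Cmul
    (Cdiv (Cmul (Cmul (poch a n) (poch (Rp1 k a b) n)) (poch (Rp2 k a b) n))
          (Cmul (Cmul (NtoC (fact n)) (poch (Rc1 k a b) n)) (poch (Rc2 k a b) n)))
    (Cmul (Q3 k a b n) (Cpown x n)).

(* Main.v *)
(* After division by (1 - x/4)^a the left-hand side is
   sum_m (a)_{3m} x^{2m} / (64^m m! (b1)_m (b2)_m) * (1 - x/4)^(-a-3m).  Expanding the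
   binomials turns the coefficient of x^n into (a)_n / (4^n n!) times the terminating
   3F2(-n/2, (1-n)/2, a+n; b1, b2; 1), whose parametric excess is k + 1.  For k = 0 this
   is Saalschutz's sum.  In general a + n = A - k with A independent of k, and the
   Vandermonde expansion (A-k)_m / m! = sum_j (-k)_j/j! * (A)_{m-j}/(m-j)! splits the 3F2
   into k + 1 Saalschutzian sums with (n, b1, b2) shifted to (n - 2j, b1 + j, b2 + j);
   these are the k + 1 terms of Q_k.  The rearrangement is justified by a geometric
   majorant for the double series in (m, l), l being the index of the binomial series. *)

From Stdlib Require Import Reals Lra Lia Arith ZArith Ring Field.
From Coquelicot Require Import Rbar Lim_seq Hierarchy Series PSeries Derive AutoDerive Continuity.
From Coquelicot Require Complex.
Require Import Defs.
Open Scope R_scope.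

(** Put [c = Rp2 + k] and [d = Rp1 + k]. The lower parameters on the left are then [c + 1/2] and
    [d + 1/2], those on the right are [2c] and [2d], and [a = c + d - 1/2 - k]. So
    [A = c + d - 1/2 + n], which does not change when (n, c, d) becomes (n - 2j, c + j, d + j): this
    is why all the pieces are balanced at once. Saalschutz's sum needs an upper parameter [-N];
    which of [-n/2] and [(1-n)/2] has that form depends on the parity of n, and the duplication
    formula for [(2c)_n] gives both parities the same closed form. On the analytic side the power is
    a principal branch with complex exponent. The binomial theorem is obtained from a differential
    equation in a real parameter on the segment from 0 to x/4, and the exponents [-a - 3m] are
    reached from [-a] by induction, each step costing one factor [1 - x/4], so that no addition law
    for [Cpow] enters. *)

Lemma Cplx_eq (z w : Cplx) : Cre z = Cre w -> Cim z = Cim w -> z = w.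
Proof. destruct z, w; simpl; intros -> ->; reflexivity. Qed.

(* Field structure of the complex numbers and casts from the naturals *)
Declare Scope cplx_scope.
Delimit Scope cplx_scope with cx.
Bind Scope cplx_scope with Cplx.
Arguments Cnorm z%_cx.
Arguments Cnorm2 z%_cx.
Arguments Cre z%_cx.
Arguments Cim z%_cx.
Infix "+" := Cadd : cplx_scope.
Infix "-" := Csub : cplx_scope.
Infix "*" := Cmul : cplx_scope.
Infix "/" := Cdiv : cplx_scope.
Notation "- z" := (Copp z) : cplx_scope.
Notation "/ z" := (Cinv z) : cplx_scope.

Lemma Cplx_ring_theory : ring_theory Czero Cone Cadd Cmul Csub Copp eq.
Proof.
  split; intros; apply Cplx_eq;
    unfold Csub, Cadd, Cmul, Copp, Czero, Cone, RtoC; simpl; ring.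
Qed.

Lemma Cnorm2_pos (z : Cplx) : z <> Czero -> 0 < Cnorm2 z.
Proof.
  intros Hz; unfold Cnorm2.
  destruct (Req_dec (Cre z) 0) as [Hr|Hr].
  - destruct (Req_dec (Cim z) 0) as [Hi|Hi].
    + exfalso; apply Hz, Cplx_eq; assumption.
    + nra.
  - nra.
Qed.

Lemma Cinv_l (z : Cplx) : z <> Czero -> Cmul (Cinv z) z = Cone.
Proof.
  intros Hz; pose proof (Cnorm2_pos z Hz) as H.
  apply Cplx_eq; unfold Cmul, Cinv, Cone, RtoC; simpl; unfold Cnorm2 in *; field; lra.
Qed.

Lemma RtoC_inj (r s : R) : RtoC r = RtoC s -> r = s.
Proof. intros H; exact (f_equal Cre H). Qed.

Lemma Cplx_field_theory :
  field_theory Czero Cone Cadd Cmul Csub Copp Cdiv Cinv eq.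
Proof.
  split.
  - exact Cplx_ring_theory.
  - intros H; apply RtoC_inj in H; lra.
  - reflexivity.
  - exact Cinv_l.
Qed.

(** Lets [ring] and [field] compute with [RtoC] of an integer literal as a numeral. A fraction such
    as [half] is not a literal, hence the frequent rewriting of fractions as quotients of
    literals. *)
Lemma Cplx_IZR_morph :
  ring_morph Czero Cone Cadd Cmul Csub Copp eq
    0%Z 1%Z Z.add Z.mul Z.sub Z.opp Z.eqb (fun z => RtoC (IZR z)).
Proof.
  split; try reflexivity; intros.
  - apply Cplx_eq; simpl; [apply plus_IZR | ring].
  - apply Cplx_eq; simpl; [apply minus_IZR | ring].
  - apply Cplx_eq; simpl; [rewrite mult_IZR; ring | ring].
  - apply Cplx_eq; simpl; [apply opp_IZR | ring].
  - apply Z.eqb_eq in H; subst; reflexivity.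
Qed.

Ltac Cplx_cst t :=
  lazymatch t with
  | Czero => constr:(0%Z)
  | Cone => constr:(1%Z)
  | RtoC (IZR ?z) =>
      match isZcst z with
      | true => z
      | _ => constr:(InitialRing.NotConstant)
      end
  | _ => constr:(InitialRing.NotConstant)
  end.

Add Field Cplx_field : Cplx_field_theory
  (morphism Cplx_IZR_morph, constants [Cplx_cst]).

Open Scope cplx_scope.

Lemma RtoC_neq0 (r : R) : r <> 0%R -> RtoC r <> Czero.
Proof. intros H E; apply H, RtoC_inj, E. Qed.

Lemma Cmul_neq0 (z w : Cplx) : z <> Czero -> w <> Czero -> z * w <> Czero.
Proof.
  intros Hz Hw E; apply Hw.
  replace w with (/ z * (z * w)) by (field; assumption).
  rewrite E; ring.
Qed.

Lemma NtoC_S (n : nat) : NtoC (S n) = NtoC n + Cone.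
Proof. unfold NtoC; rewrite S_INR; apply Cplx_eq; simpl; ring. Qed.

Lemma NtoC_add (m n : nat) : NtoC (m + n) = NtoC m + NtoC n.
Proof. unfold NtoC; rewrite plus_INR; apply Cplx_eq; simpl; ring. Qed.

Lemma NtoC_mul (m n : nat) : NtoC (m * n) = NtoC m * NtoC n.
Proof. unfold NtoC; rewrite mult_INR; apply Cplx_eq; simpl; ring. Qed.

Lemma NtoC_0 : NtoC 0 = Czero.
Proof. reflexivity. Qed.

Lemma NtoC_2 : NtoC 2 = RtoC 2.
Proof. reflexivity. Qed.

Lemma NtoC_sub (m n : nat) : (n <= m)%nat -> NtoC (m - n) = NtoC m - NtoC n.
Proof. intros H; unfold NtoC; rewrite minus_INR by easy; apply Cplx_eq; simpl; ring. Qed.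

Lemma NtoC_neq0 (n : nat) : n <> 0%nat -> NtoC n <> Czero.
Proof. intros H; apply RtoC_neq0, not_0_INR, H. Qed.

Lemma NtoC_S_neq0 (n : nat) : NtoC n + Cone <> Czero.
Proof. rewrite <- NtoC_S; apply NtoC_neq0; lia. Qed.

Lemma NtoC_fact_neq0 (n : nat) : NtoC (fact n) <> Czero.
Proof. apply NtoC_neq0, fact_neq_0. Qed.

Lemma NtoC_fact_S (n : nat) : NtoC (fact (S n)) = (NtoC n + Cone) * NtoC (fact n).
Proof. rewrite <- NtoC_S, <- NtoC_mul; reflexivity. Qed.

Lemma RtoC_div (r s : R) : s <> 0%R -> RtoC (r / s) = RtoC r / RtoC s.
Proof. intros H; apply Cplx_eq; unfold Cdiv, Cinv, Cnorm2; simpl; field; lra. Qed.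

Lemma half_eq : half = Cone / RtoC 2.
Proof. apply RtoC_div; lra. Qed.

Ltac Cnz := cbv beta;
  repeat match goal with
  | |- _ /\ _ => split
  | |- Cmul _ _ <> Czero => apply Cmul_neq0
  | |- RtoC _ <> Czero => apply RtoC_neq0; lra
  | |- Cone <> Czero => apply (RtoC_neq0 1); lra
  | |- NtoC (fact _) <> Czero => apply NtoC_fact_neq0
  | |- NtoC _ + _ <> Czero => apply NtoC_S_neq0
  | _ => assumption
  end.

(** * Pochhammer symbols and finite sums *)

Lemma poch_S (c : Cplx) (n : nat) : poch c (S n) = poch c n * (c + NtoC n).
Proof. reflexivity. Qed.

Lemma poch_add (c : Cplx) (m n : nat) :
  poch c (m + n) = poch c m * poch (c + NtoC m) n.
Proof.
  induction n as [|n IH].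
  - rewrite Nat.add_0_r; simpl; ring.
  - rewrite Nat.add_succ_r, !poch_S, IH, NtoC_add; ring.
Qed.

Lemma poch_S_l (c : Cplx) (n : nat) : poch c (S n) = c * poch (c + Cone) n.
Proof.
  change (S n) with (1 + n)%nat; rewrite poch_add; simpl poch.
  change (NtoC 1) with Cone; change (NtoC 0) with Czero; ring.
Qed.

Lemma not_nonpos_int_add (c : Cplx) (m : nat) : not_nonpos_int c -> c + NtoC m <> Czero.
Proof.
  intros H E; apply (H m).
  replace c with (c + NtoC m - NtoC m) by ring; rewrite E; ring.
Qed.

Lemma not_nonpos_int_shift (c : Cplx) (m : nat) :
  not_nonpos_int c -> not_nonpos_int (c + NtoC m).
Proof.
  intros H j E; apply (H (j + m)%nat).
  replace c with (c + NtoC m - NtoC m) by ring; rewrite E, NtoC_add; ring.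
Qed.

Lemma poch_neq0 (c : Cplx) (n : nat) : not_nonpos_int c -> poch c n <> Czero.
Proof.
  intros H; induction n as [|n IH].
  - apply (RtoC_neq0 1); lra.
  - rewrite poch_S; apply Cmul_neq0; [exact IH | now apply not_nonpos_int_add].
Qed.

Lemma poch_neg_nat_eq0 (N m : nat) : (N < m)%nat -> poch (- NtoC N) m = Czero.
Proof.
  intros H; replace m with (S N + (m - S N))%nat by lia.
  rewrite poch_add, poch_S; ring.
Qed.

(** The factors on the left are [-(c+m-1), ..., -c], that is, those of [poch c m] negated and in
    reverse order. *)
Lemma poch_reflect (c : Cplx) (m : nat) :
  poch (Cone - c - NtoC m) m = Cpown (- Cone) m * poch c m.
Proof.
  revert c; induction m as [|m IH]; intros c.
  - simpl; ring.
  - rewrite poch_S_l, poch_S, NtoC_S.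
    replace (Cone - c - (NtoC m + Cone) + Cone) with (Cone - c - NtoC m) by ring.
    rewrite IH; simpl; ring.
Qed.

Lemma poch_double (c : Cplx) (N : nat) :
  poch (RtoC 2 * c) (2 * N) =
  Cpown (RtoC 4) N * poch c N * poch (c + half) N.
Proof.
  induction N as [|N IH].
  - simpl; ring.
  - replace (2 * S N)%nat with (S (S (2 * N))) by lia.
    rewrite !poch_S, IH, NtoC_S, NtoC_mul, half_eq; simpl Cpown.
    rewrite NtoC_2.
    field; Cnz.
Qed.

Lemma Csum_ext (f g : nat -> Cplx) (n : nat) :
  (forall i, (i <= n)%nat -> f i = g i) -> Csum f n = Csum g n.
Proof.
  induction n as [|n IH]; intros H; simpl.
  - apply H; lia.
  - rewrite IH, H; auto.
Qed.

Lemma Csum_scal (c : Cplx) (f : nat -> Cplx) (n : nat) :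
  Csum (fun i => c * f i) n = c * Csum f n.
Proof. induction n as [|n IH]; simpl; [reflexivity | rewrite IH; ring]. Qed.

Lemma Csum_sub (f g : nat -> Cplx) (n : nat) :
  Csum (fun i => f i - g i) n = Csum f n - Csum g n.
Proof. induction n as [|n IH]; simpl; [reflexivity | rewrite IH; ring]. Qed.

Lemma Csum_add (f g : nat -> Cplx) (n : nat) :
  Csum (fun i => f i + g i) n = Csum f n + Csum g n.
Proof. induction n as [|n IH]; simpl; [reflexivity | rewrite IH; ring]. Qed.

Lemma Csum_S_l (f : nat -> Cplx) (n : nat) :
  Csum f (S n) = f 0%nat + Csum (fun i => f (S i)) n.
Proof.
  induction n as [|n IH]; [reflexivity|].
  change (Csum f (S (S n))) with (Csum f (S n) + f (S (S n))).
  rewrite IH; simpl; ring.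
Qed.

Lemma Csum_trailing_zeros (f : nat -> Cplx) (n m : nat) :
  (n <= m)%nat -> (forall i, (n < i)%nat -> f i = Czero) -> Csum f m = Csum f n.
Proof.
  intros Hnm H; induction Hnm as [|m Hnm IH]; [reflexivity|].
  simpl; rewrite IH, H by lia; ring.
Qed.

Lemma Csum_triangle (f : nat -> nat -> Cplx) (n : nat) :
  Csum (fun m => Csum (fun j => f j (m - j)%nat) m) n =
  Csum (fun j => Csum (fun i => f j i) (n - j)) n.
Proof.
  induction n as [|n IH]; [reflexivity|].
  assert (HS : forall g, Csum g (S n) = Csum g n + g (S n)) by reflexivity.
  rewrite !HS, IH, Nat.sub_diag.
  rewrite (Csum_ext (fun j => Csum (fun i => f j i) (S n - j))
    (fun j => Csum (fun i => f j i) (n - j) + f j (S n - j)%nat)).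
  - rewrite Csum_add; simpl; ring.
  - intros j Hj; replace (S n - j)%nat with (S (n - j)) by lia; reflexivity.
Qed.

(** * The terminating 3F2 at unit argument *)

(** The upper limit [M] is free so that the sums for [N] and [N + 1] run over one range. A
    first-order recurrence in [N], with coefficients read off the closed form, holds up to a
    telescoping term [G], and [G M] vanishes once [N < M]. *)
Lemma saalschutz (A C D : Cplx) (N M : nat) :
  not_nonpos_int C -> not_nonpos_int D -> (N <= M)%nat ->
  Csum (fun m => poch (- NtoC N) m * poch A m * poch (C + D + NtoC N - Cone - A) m
                 / (NtoC (fact m) * poch C m * poch D m)) M
  = poch (C - A) N * poch (D - A) N / (poch C N * poch D N).
Proof.
  intros HC HD; induction N as [|N IH]; intros HM.
  - rewrite (Csum_trailing_zeros _ 0) by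
      (try lia; intros i Hi; rewrite poch_neg_nat_eq0 by easy;
       unfold Cdiv; ring).
    simpl; change (NtoC 1) with Cone; field; Cnz.
  - specialize (IH ltac:(lia)).
    set (u := fun N m => poch (- NtoC N) m * poch A m * poch (C + D + NtoC N - Cone - A) m
                 / (NtoC (fact m) * poch C m * poch D m)).
    (* Chosen so that [(C+N)(D+N) - (C-A+N)(D-A+N) = kappa * A], which is the telescoping identity
       at [m = 0]. *)
    set (kappa := C + D + RtoC 2 * NtoC N - A).
    (* The certificate of the Wilf-Zeilberger recurrence in [N]. *)
    set (G := fun m => kappa * (poch (- NtoC N) m * poch A (S m)
                 * poch (C + D + NtoC N - A) m) / (NtoC (fact m) * poch C m * poch D m)).
    assert (Htel : forall m,
      Csum (fun m => (C + NtoC N) * (D + NtoC N) * u (S N) m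
        - (C - A + NtoC N) * (D - A + NtoC N) * u N m) m = G m).
    { induction m as [|m IHm].
      - unfold u, G, kappa; simpl; change (NtoC 1) with Cone; rewrite NtoC_0.
        field; Cnz.
      - change (Csum ?f (S m)) with (Csum f m + f (S m)); rewrite IHm.
        unfold u, G.
        rewrite (poch_S_l (- NtoC (S N))), NtoC_S.
        rewrite (poch_S_l (C + D + NtoC N - Cone - A)).
        rewrite !NtoC_fact_S, !(poch_S A), !(poch_S C), !(poch_S D).
        rewrite (poch_S (- NtoC N)), (poch_S (C + D + NtoC N - A)).
        replace (- (NtoC N + Cone) + Cone) with (- NtoC N) by ring.
        replace (C + D + NtoC N - Cone - A + Cone) with (C + D + NtoC N - A) by ring.
        replace (C + D + (NtoC N + Cone) - Cone - A) with (C + D + NtoC N - A) by ring.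
        rewrite (poch_S (C + D + NtoC N - A)), NtoC_S.
        pose proof (poch_neq0 C m HC); pose proof (poch_neq0 D m HD).
        pose proof (not_nonpos_int_add C m HC); pose proof (not_nonpos_int_add D m HD).
        unfold kappa; field; Cnz. }
    specialize (Htel M).
    rewrite Csum_sub, !Csum_scal in Htel.
    assert (HG : G M = Czero)
      by (unfold G; rewrite poch_neg_nat_eq0 by lia; unfold Cdiv; ring).
    rewrite HG in Htel; fold (u N) in IH; rewrite IH in Htel; fold (u (S N)).
    pose proof (poch_neq0 C N HC); pose proof (poch_neq0 D N HD).
    pose proof (not_nonpos_int_add C N HC); pose proof (not_nonpos_int_add D N HD).
    rewrite !poch_S.
    set (S1 := Csum (u (S N)) M) in *.
    replace S1 with (((C + NtoC N) * (D + NtoC N) * S1) / ((C + NtoC N) * (D + NtoC N)))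
      by (field; Cnz).
    replace ((C + NtoC N) * (D + NtoC N) * S1) with
      ((C - A + NtoC N) * (D - A + NtoC N) *
       (poch (C - A) N * poch (D - A) N / (poch C N * poch D N))).
    + field; Cnz.
    + match type of Htel with ?x - ?y = _ =>
        replace x with (x - y + y) by ring; rewrite Htel; ring end.
Qed.

Lemma Cpown_add (z : Cplx) (m n : nat) : Cpown z (m + n) = Cpown z m * Cpown z n.
Proof.
  induction n as [|n IH].
  - rewrite Nat.add_0_r; simpl; ring.
  - rewrite Nat.add_succ_r; simpl; rewrite IH; ring.
Qed.

Lemma Cpown_mul_base (z w : Cplx) (n : nat) : Cpown (z * w) n = Cpown z n * Cpown w n.
Proof. induction n as [|n IH]; simpl; [ring | rewrite IH; ring]. Qed.

Lemma Cpown_mul (z : Cplx) (m n : nat) : Cpown z (m * n) = Cpown (Cpown z m) n.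
Proof.
  induction n as [|n IH].
  - rewrite Nat.mul_0_r; reflexivity.
  - rewrite Nat.mul_succ_r, Cpown_add, IH; reflexivity.
Qed.

Lemma Cpown_neq0 (z : Cplx) (n : nat) : z <> Czero -> Cpown z n <> Czero.
Proof.
  intros Hz; induction n as [|n IH]; simpl; [apply (RtoC_neq0 1); lra | Cnz].
Qed.

Lemma Cpown_one (n : nat) : Cpown Cone n = Cone.
Proof. induction n as [|n IH]; simpl; [reflexivity | rewrite IH; ring]. Qed.

Lemma half_double (z : Cplx) : z = half * (RtoC 2 * z).
Proof. rewrite half_eq; field; Cnz. Qed.

(** This is [(-n)_{2m} / 4^m]: it equals [n! / (4^m (n-2m)!)] for [2m <= n] and 0 beyond, and
    raising [m] by [j] amounts to lowering [n] by [2j]. *)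
Definition half_poch (n m : nat) : Cplx :=
  poch (- (half * NtoC n)) m * poch (- (half * NtoC n) + half) m.

(** For [r = 2N] the terminating parameter is [-r/2] and the other one is [1/2 - N]; for
    [r = 2N + 1] it is [(1-r)/2] and the other one is [-1/2 - N]. In both cases [c + d - 1/2 + r] is
    exactly the third parameter demanded by the balance condition. *)
Lemma saalschutz_half (c d : Cplx) (r M : nat) :
  not_nonpos_int (c + half) -> not_nonpos_int (d + half) ->
  not_nonpos_int (RtoC 2 * c) -> not_nonpos_int (RtoC 2 * d) -> (r <= M)%nat ->
  Csum (fun m => half_poch r m * poch (c + d - half + NtoC r) m
                 / (NtoC (fact m) * poch (c + half) m * poch (d + half) m)) M
  = Cpown (RtoC 4) r * poch c r * poch d r
    / (poch (RtoC 2 * c) r * poch (RtoC 2 * d) r).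
Proof.
  intros Hc Hd Hc2 Hd2 HM.
  pose proof (poch_neq0 _ r Hc2) as Hc2r; pose proof (poch_neq0 _ r Hd2) as Hd2r.
  destruct (Nat.Even_or_Odd r) as [[N ->]|[N ->]].
  - rewrite !poch_double in *.
    rewrite (Csum_ext _ (fun m => poch (- NtoC N) m * poch (half - NtoC N) m
       * poch ((c + half) + (d + half) + NtoC N - Cone - (half - NtoC N)) m
       / (NtoC (fact m) * poch (c + half) m * poch (d + half) m))).
    2: { intros m _; unfold half_poch; rewrite NtoC_mul.
         rewrite NtoC_2.
         rewrite <- half_double.
         replace (c + half + (d + half) + NtoC N - Cone - (half - NtoC N))
           with (c + d - half + RtoC 2 * NtoC N) by (rewrite half_eq; field; Cnz).
         replace (- NtoC N + half) with (half - NtoC N) by ring.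
         reflexivity. }
    rewrite saalschutz by (easy || lia).
    replace (c + half - (half - NtoC N)) with (c + NtoC N) by ring.
    replace (d + half - (half - NtoC N)) with (d + NtoC N) by ring.
    (* Duplication leaves a factor [(c)_N], which would complete the [(c+N)_N] of Saalschutz's sum
       to the [(c)_{2N}] on the right. That [(c)_N] is nonzero follows because it divides
       [(2c)_{2N}]. *)
    replace (2 * N)%nat with (N + N)%nat by lia.
    rewrite !poch_add, Cpown_add.
    pose proof (poch_neq0 _ N Hc); pose proof (poch_neq0 _ N Hd).
    assert (poch c N <> Czero) by (intros E; apply Hc2r; rewrite E; ring).
    assert (poch d N <> Czero) by (intros E; apply Hd2r; rewrite E; ring).
    assert (Cpown (RtoC 4) N <> Czero) by (apply Cpown_neq0; Cnz).
    field; Cnz.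
  - replace (2 * N + 1)%nat with (S (2 * N)) in * by lia.
    rewrite !(poch_S (RtoC 2 * _)), !poch_double in *.
    rewrite (Csum_ext _ (fun m => poch (- NtoC N) m * poch (- half - NtoC N) m
       * poch ((c + half) + (d + half) + NtoC N - Cone - (- half - NtoC N)) m
       / (NtoC (fact m) * poch (c + half) m * poch (d + half) m))).
    2: { intros m _; unfold half_poch; rewrite NtoC_S, NtoC_mul.
         rewrite NtoC_2.
         replace (c + half + (d + half) + NtoC N - Cone - (- half - NtoC N))
           with (c + d - half + (RtoC 2 * NtoC N + Cone)) by (rewrite half_eq; field; Cnz).
         replace (- (half * (RtoC 2 * NtoC N + Cone))) with (- half - NtoC N)
           by (rewrite half_eq; field; Cnz).
         replace (- half - NtoC N + half) with (- NtoC N) by ring.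
         unfold Cdiv; ring. }
    rewrite saalschutz by (easy || lia).
    replace (c + half - (- half - NtoC N)) with (c + NtoC (S N))
      by (rewrite NtoC_S, half_eq; field; Cnz).
    replace (d + half - (- half - NtoC N)) with (d + NtoC (S N))
      by (rewrite NtoC_S, half_eq; field; Cnz).
    replace (S (2 * N))%nat with (S N + N)%nat by lia.
    rewrite !poch_add, Cpown_add, !poch_S.
    simpl (Cpown _ (S N)).
    rewrite NtoC_mul in *.
    change (NtoC 2) with (RtoC 2) in *.
    pose proof (poch_neq0 _ N Hc); pose proof (poch_neq0 _ N Hd).
    assert (poch c N <> Czero) by (intros E; apply Hc2r; rewrite E; ring).
    assert (poch d N <> Czero) by (intros E; apply Hd2r; rewrite E; ring).
    assert (c + NtoC N <> Czero).
    { intros E; apply Hc2r.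
      replace (RtoC 2 * c + RtoC 2 * NtoC N) with (RtoC 2 * (c + NtoC N)) by ring.
      rewrite E; ring. }
    assert (d + NtoC N <> Czero).
    { intros E; apply Hd2r.
      replace (RtoC 2 * d + RtoC 2 * NtoC N) with (RtoC 2 * (d + NtoC N)) by ring.
      rewrite E; ring. }
    assert (Cpown (RtoC 4) N <> Czero) by (apply Cpown_neq0; Cnz).
    assert (RtoC 2 * c + RtoC 2 * NtoC N <> Czero)
      by (intros E; apply Hc2r; rewrite E; ring).
    assert (RtoC 2 * d + RtoC 2 * NtoC N <> Czero)
      by (intros E; apply Hd2r; rewrite E; ring).
    field; Cnz.
Qed.

(* The coefficient of [z^m] in [(1 - z)^(-s)]. *)
Definition binc (s : Cplx) (m : nat) : Cplx := poch s m / NtoC (fact m).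

(** Pascal's rule: multiplying the series of [(1 - z)^(-s)] by [1 - z] lowers [s] by one. It drives
    both the Vandermonde expansion and the change of exponent in the binomial series. *)
Lemma binc_pred (s : Cplx) (m : nat) :
  binc (s - Cone) (S m) = binc s (S m) - binc s m.
Proof.
  unfold binc; rewrite poch_S_l, poch_S, NtoC_fact_S.
  replace (s - Cone + Cone) with s by ring; field; Cnz.
Qed.

(** Coefficient comparison in [(1-z)^(k-A) = (1-z)^k (1-z)^(-A)]. As [k] is a natural number, [k]
    applications of Pascal's rule suffice. The terms with [j > k] are zero. *)
Lemma binc_vandermonde_neg (A : Cplx) (k m : nat) :
  binc (A - NtoC k) m =
  Csum (fun j => binc (- NtoC k) j * binc A (m - j)) m.
Proof.
  revert m; induction k as [|k IH]; intros m.
  - rewrite (Csum_trailing_zeros _ 0).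
    + cbn [Csum]; rewrite Nat.sub_0_r, NtoC_0; replace (A - Czero) with A by ring.
      unfold binc at 2; simpl; change (NtoC 1) with Cone; field; Cnz.
    + lia.
    + intros i Hi; unfold binc; rewrite poch_neg_nat_eq0 by easy; unfold Cdiv; ring.
  - rewrite NtoC_S.
    replace (A - (NtoC k + Cone)) with (A - NtoC k - Cone) by ring.
    replace (- (NtoC k + Cone)) with (- NtoC k - Cone) by ring.
    destruct m as [|m].
    + unfold binc; simpl; change (NtoC 1) with Cone; field; Cnz.
    + rewrite binc_pred, !IH, !Csum_S_l.
      rewrite (Csum_ext (fun i => binc (- NtoC k - Cone) (S i) * binc A (S m - S i))
        (fun i => binc (- NtoC k) (S i) * binc A (S m - S i)
                  - binc (- NtoC k) i * binc A (m - i))).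
      * rewrite Csum_sub.
        replace (binc (- NtoC k - Cone) 0) with (binc (- NtoC k) 0) by reflexivity; ring.
      * intros i _; rewrite binc_pred; simpl; ring.
Qed.

Lemma half_poch_add (n j i : nat) : (2 * j <= n)%nat ->
  half_poch n (j + i) = half_poch n j * half_poch (n - 2 * j) i.
Proof.
  intros H; unfold half_poch; rewrite !poch_add, NtoC_sub, NtoC_mul by easy.
  rewrite NtoC_2.
  replace (- (half * (NtoC n - RtoC 2 * NtoC j))) with (- (half * NtoC n) + NtoC j)
    by (rewrite half_eq; field; Cnz).
  replace (- (half * NtoC n) + half + NtoC j) with (- (half * NtoC n) + NtoC j + half) by ring.
  ring.
Qed.

Lemma half_poch_falling (n m : nat) : (2 * m <= n)%nat ->
  half_poch n m * NtoC (fact (n - 2 * m)) * Cpown (RtoC 4) m = NtoC (fact n).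
Proof.
  induction m as [|m IH]; intros H.
  - rewrite Nat.sub_0_r; unfold half_poch; simpl; ring.
  - rewrite <- IH by lia.
    remember (n - 2 * S m)%nat as r eqn:Hr.
    replace (n - 2 * m)%nat with (S (S r)) by lia.
    assert (Hn : NtoC n = NtoC r + RtoC 2 * NtoC m + RtoC 2).
    { replace n with (r + (m + m) + 2)%nat by lia.
      rewrite !NtoC_add; rewrite NtoC_2; ring. }
    unfold half_poch; rewrite !poch_S, !NtoC_fact_S, NtoC_S; simpl Cpown.
    generalize (poch (- (half * NtoC n)) m) (poch (- (half * NtoC n) + half) m).
    intros p q; rewrite Hn, half_eq; field; Cnz.
Qed.

Lemma half_poch_eq0 (n m : nat) : (n < 2 * m)%nat -> half_poch n m = Czero.
Proof.
  intros H; unfold half_poch.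
  destruct (Nat.Even_or_Odd n) as [[N ->]|[N ->]];
    rewrite ?NtoC_add, NtoC_mul;
    rewrite NtoC_2.
  - rewrite <- half_double, poch_neg_nat_eq0 by lia; ring.
  - replace (- (half * (RtoC 2 * NtoC N + NtoC 1)) + half) with (- NtoC N).
    + rewrite (poch_neg_nat_eq0 N) by lia; ring.
    + change (NtoC 1) with Cone; rewrite half_eq; field; Cnz.
Qed.

(** After Vandermonde and an exchange of sums, the inner sum for fixed [j] is [saalschutz_half] with
    (n - 2j, c + j, d + j). Its third upper parameter is [A] for every [j]. *)
Lemma hypergeom_coef_sum (c d : Cplx) (k n : nat) :
  not_nonpos_int (c + half) -> not_nonpos_int (d + half) ->
  not_nonpos_int (RtoC 2 * c) -> not_nonpos_int (RtoC 2 * d) ->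
  Csum (fun m => half_poch n m * poch (c + d - half + NtoC n - NtoC k) m
                 / (NtoC (fact m) * poch (c + half) m * poch (d + half) m)) n
  = Cpown (RtoC 4) n / (poch (RtoC 2 * c) n * poch (RtoC 2 * d) n)
    * Csum (fun j => half_poch n j * binc (- NtoC k) j
                     * (poch c (n - j) * poch d (n - j))) n.
Proof.
  intros Hc Hd Hc2 Hd2.
  set (A := c + d - half + NtoC n).
  set (f := fun j i => half_poch n (j + i) * binc (- NtoC k) j * binc A i
                       / (poch (c + half) (j + i) * poch (d + half) (j + i))).
  transitivity (Csum (fun m => Csum (fun j => f j (m - j)%nat) m) n).
  { apply Csum_ext; intros m _.
    pose proof (poch_neq0 _ m Hc); pose proof (poch_neq0 _ m Hd).
    transitivity (half_poch n m / (poch (c + half) m * poch (d + half) m)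
                  * binc (A - NtoC k) m).
    - unfold binc; field; Cnz.
    - rewrite binc_vandermonde_neg, <- Csum_scal.
      apply Csum_ext; intros j Hj; unfold f.
      replace (j + (m - j))%nat with m by lia; field; Cnz. }
  rewrite Csum_triangle, <- Csum_scal.
  apply Csum_ext; intros j Hj.
  pose proof (poch_neq0 _ n Hc2); pose proof (poch_neq0 _ n Hd2).
  (* For [2j > n] both sides vanish through [half_poch]; otherwise the inner range [n - j] exceeds
     the needed [n - 2j] harmlessly. *)
  destruct (le_lt_dec (2 * j) n) as [Hjn|Hjn].
  - pose proof (poch_neq0 _ j Hc) as Hcj; pose proof (poch_neq0 _ j Hd) as Hdj.
    rewrite (Csum_ext _ (fun i =>
      half_poch n j * binc (- NtoC k) j / (poch (c + half) j * poch (d + half) j)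
      * (half_poch (n - 2 * j) i
         * poch (c + NtoC j + (d + NtoC j) - half + NtoC (n - 2 * j)) i
         / (NtoC (fact i) * poch (c + NtoC j + half) i * poch (d + NtoC j + half) i)))).
    2: { intros i _; unfold f, binc.
         rewrite half_poch_add, NtoC_sub, NtoC_mul, NtoC_2, !(poch_add (_ + half)) by easy.
         replace (c + NtoC j + (d + NtoC j) - half + (NtoC n - RtoC 2 * NtoC j))
           with A by (unfold A; ring).
         replace (c + NtoC j + half) with (c + half + NtoC j) by ring.
         replace (d + NtoC j + half) with (d + half + NtoC j) by ring.
         pose proof (poch_neq0 _ i (not_nonpos_int_shift _ j Hc)).
         pose proof (poch_neq0 _ i (not_nonpos_int_shift _ j Hd)).
         field; Cnz. }
    assert (Hshift : forall e, RtoC 2 * (e + NtoC j) = RtoC 2 * e + NtoC (2 * j)).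
    { intros e; rewrite NtoC_mul, NtoC_2; ring. }
    rewrite Csum_scal, saalschutz_half; rewrite ?Hshift; try lia;
      try (apply not_nonpos_int_shift; assumption).
    2: { replace (c + NtoC j + half) with (c + half + NtoC j) by ring.
         apply not_nonpos_int_shift; assumption. }
    2: { replace (d + NtoC j + half) with (d + half + NtoC j) by ring.
         apply not_nonpos_int_shift; assumption. }
    (* What remains is bookkeeping with [n = 2j + r]: [(2c)_n = (2c)_{2j} (2c+2j)_r] and
       [(2c)_{2j} = 4^j (c)_j (c+1/2)_j]. The two factors [4^j] absorb the [16^j] in [4^n], and
       [(c+1/2)_j] matches the prefactor of the inner sum. *)
    replace (n - j)%nat with (j + (n - 2 * j))%nat by lia.
    remember (n - 2 * j)%nat as r eqn:Hr.
    assert (Hn : n = (2 * j + r)%nat) by lia.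
    generalize (half_poch n j) (binc (- NtoC k) j); intros p q.
    rewrite Hn in *.
    rewrite !(poch_add c), !(poch_add d), !(poch_add (RtoC 2 * _)), !poch_double,
      Cpown_add, Cpown_mul in *.
    replace (Cpown (RtoC 4) 2) with (RtoC 4 * RtoC 4) by (simpl; ring).
    rewrite Cpown_mul_base.
    assert (Cpown (RtoC 4) j <> Czero) by (apply Cpown_neq0; Cnz).
    pose proof (poch_neq0 _ r (not_nonpos_int_shift _ (2 * j) Hc2)).
    pose proof (poch_neq0 _ r (not_nonpos_int_shift _ (2 * j) Hd2)).
    pose proof (poch_neq0 _ (2 * j) Hc2) as Hcjj; rewrite poch_double in Hcjj.
    pose proof (poch_neq0 _ (2 * j) Hd2) as Hdjj; rewrite poch_double in Hdjj.
    assert (poch c j <> Czero) by (intros E; apply Hcjj; rewrite E; ring).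
    assert (poch d j <> Czero) by (intros E; apply Hdjj; rewrite E; ring).
    field; Cnz.
  - rewrite (half_poch_eq0 n j) by easy.
    rewrite (Csum_ext _ (fun i => Czero * Czero)).
    + rewrite Csum_scal; ring.
    + intros i _; unfold f; rewrite half_poch_eq0 by lia; unfold Cdiv; ring.
Qed.

Lemma Cpown_opp_one_sqr (m : nat) : Cpown (- Cone) m * Cpown (- Cone) m = Cone.
Proof.
  rewrite <- Cpown_mul_base; replace (- Cone * - Cone) with Cone by ring; apply Cpown_one.
Qed.

Lemma Cpown_opp_one_neq0 (m : nat) : Cpown (- Cone) m <> Czero.
Proof.
  apply Cpown_neq0; intros E; apply (RtoC_neq0 1); [lra|].
  change (RtoC 1) with Cone; replace Cone with (- - Cone) by ring; rewrite E; ring.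
Qed.

(** Since [u = 1 - p1 - k], reflection turns [(u-n+j)_{k-j}] into a sign times [(p1+n)_{k-j}]. The
    factor [(p1)_n] extends this to [(p1)_{n+k-j} = (p1)_k (p1+k)_{n-j}], and [(p1)_k] cancels
    [(u)_k] up to sign. The same holds for [v] and [p2], so every sign occurs squared. *)
Lemma Q3_eq (k : nat) (a b : Cplx) (n : nat) :
  poch (Cu k a b) k <> Czero -> poch (Cv k a b) k <> Czero ->
  poch (Rp1 k a b) n * poch (Rp2 k a b) n * Q3 k a b n
  = Csum (fun j => half_poch n j * binc (- NtoC k) j
      * (poch (Rp1 k a b + NtoC k) (n - j) * poch (Rp2 k a b + NtoC k) (n - j))) n.
Proof.
  intros Hu Hv.
  assert (H34 : RtoC (3 / 4) = RtoC 3 / RtoC 4) by (apply RtoC_div; lra).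
  assert (H14 : RtoC (1 / 4) = Cone / RtoC 4) by (apply RtoC_div; lra).
  set (p1 := Rp1 k a b); set (p2 := Rp2 k a b).
  assert (Eu : Cu k a b = Cone - p1 - NtoC k)
    by (unfold p1, Cu, Rp1; rewrite H34, H14, half_eq; field; Cnz).
  assert (Ev : Cv k a b = Cone - p2 - NtoC k)
    by (unfold p2, Cv, Rp2; rewrite H34, H14, half_eq; field; Cnz).
  unfold Q3; rewrite Eu, Ev in *; cbv zeta.
  rewrite !poch_reflect in *.
  assert (Hp1 : poch p1 k <> Czero) by (intros E; apply Hu; rewrite E; ring).
  assert (Hp2 : poch p2 k <> Czero) by (intros E; apply Hv; rewrite E; ring).
  set (g := fun j => half_poch n j * binc (- NtoC k) j
      * (poch (p1 + NtoC k) (n - j) * poch (p2 + NtoC k) (n - j))).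
  (* The summand vanishes for [j > k] by [(-k)_j] and for [j > n] by [half_poch], so the limits [k]
     and [n] both agree with [n + k]. *)
  transitivity (Csum g k).
  2: { transitivity (Csum g (n + k)).
       - symmetry; apply Csum_trailing_zeros; [lia|].
         intros i Hi; unfold g, binc; rewrite poch_neg_nat_eq0 by easy; unfold Cdiv; ring.
       - apply Csum_trailing_zeros; [lia|].
         intros i Hi; unfold g; rewrite half_poch_eq0 by lia; ring. }
  match goal with |- _ * (Csum ?F k / ?den) = _ =>
    transitivity (poch p1 n * poch p2 n / den * Csum F k) end.
  { field; Cnz; apply Cpown_opp_one_neq0. }
  rewrite <- Csum_scal; apply Csum_ext; intros j Hj; unfold g.
  (* The regrouping to [n + k - j] needs [j <= n], as [n - j] is a truncated subtraction; when
     [2j > n] both terms are zero anyway. *)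
  destruct (le_lt_dec (2 * j) n) as [Hjn|Hjn].
  - assert (Hr : forall p, Cone - p - NtoC k - NtoC n + NtoC j
                 = Cone - (p + NtoC n) - NtoC (k - j)).
    { intros p; rewrite NtoC_sub by easy; ring. }
    rewrite !Hr, !poch_reflect.
    assert (Hswap : forall p, poch p n * poch (p + NtoC n) (k - j)
                    = poch p k * poch (p + NtoC k) (n - j)).
    { intros p; rewrite <- !poch_add; f_equal; lia. }
    pose proof (Cpown_opp_one_sqr k) as Hs; pose proof (Cpown_opp_one_sqr (k - j)) as Hs'.
    pose proof (Cpown_opp_one_neq0 k) as Hk.
    set (s := Cpown (- Cone) k) in *; set (s' := Cpown (- Cone) (k - j)) in *.
    transitivity (half_poch n j * binc (- NtoC k) j * (s' * s')
      * (poch p1 n * poch (p1 + NtoC n) (k - j))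
      * (poch p2 n * poch (p2 + NtoC n) (k - j)) / (s * s * poch p1 k * poch p2 k)).
    + unfold half_poch, binc; field; Cnz.
    + rewrite !Hswap, Hs, Hs'; field; Cnz.
  - transitivity (half_poch n j * Czero).
    + unfold half_poch; unfold Cdiv; 
      change (poch (- (half * NtoC n)) j * poch (- (half * NtoC n) + half) j)
        with (half_poch n j); rewrite half_poch_eq0 by easy; ring.
    + rewrite half_poch_eq0 by easy; ring.
Qed.

(** * Complex series *)

Lemma Cnorm_Cmod (z : Cplx) : Cnorm z = Complex.Cmod z.
Proof. unfold Cnorm, Cnorm2, Complex.Cmod, Cre, Cim; f_equal; simpl; ring. Qed.

Lemma Cnorm_ge0 (z : Cplx) : (0 <= Cnorm z)%R.
Proof. apply sqrt_pos. Qed.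

Lemma Cnorm_mul (z w : Cplx) : Cnorm (z * w) = (Cnorm z * Cnorm w)%R.
Proof. rewrite !Cnorm_Cmod; apply Complex.Cmod_mult. Qed.

Lemma Cnorm_add (z w : Cplx) : (Cnorm (z + w) <= Cnorm z + Cnorm w)%R.
Proof. rewrite !Cnorm_Cmod; apply Complex.Cmod_triangle. Qed.

Lemma Cnorm_opp (z : Cplx) : Cnorm (- z) = Cnorm z.
Proof. unfold Cnorm, Cnorm2; simpl; f_equal; ring. Qed.

Lemma Cnorm_RtoC (r : R) : Cnorm (RtoC r) = Rabs r.
Proof. unfold Cnorm, Cnorm2; simpl; rewrite <- sqrt_Rsqr_abs; f_equal; unfold Rsqr; ring. Qed.

Lemma Cnorm_NtoC (n : nat) : Cnorm (NtoC n) = INR n.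
Proof. unfold NtoC; rewrite Cnorm_RtoC; apply Rabs_pos_eq, pos_INR. Qed.

Lemma Cnorm_Cone : Cnorm Cone = 1%R.
Proof. unfold Cone; rewrite Cnorm_RtoC, Rabs_R1; reflexivity. Qed.

Lemma Cnorm_Czero : Cnorm Czero = 0%R.
Proof. unfold Czero; rewrite Cnorm_RtoC, Rabs_R0; reflexivity. Qed.

Lemma Cnorm_gt0 (z : Cplx) : z <> Czero -> (0 < Cnorm z)%R.
Proof. intros H; apply sqrt_lt_R0, Cnorm2_pos, H. Qed.

Lemma Cnorm_inv (z : Cplx) : z <> Czero -> Cnorm (/ z) = (/ Cnorm z)%R.
Proof.
  intros H; pose proof (Cnorm_gt0 z H).
  apply (Rmult_eq_reg_r (Cnorm z)); [|lra].
  rewrite <- Cnorm_mul, Cinv_l, Cnorm_Cone by easy; field; lra.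
Qed.

Lemma Cnorm_div (z w : Cplx) : w <> Czero -> Cnorm (z / w) = (Cnorm z / Cnorm w)%R.
Proof. intros H; unfold Cdiv; rewrite Cnorm_mul, Cnorm_inv by easy; reflexivity. Qed.

Lemma Cnorm_Cpown (z : Cplx) (n : nat) : Cnorm (Cpown z n) = (Cnorm z ^ n)%R.
Proof.
  induction n as [|n IH]; simpl; [apply Cnorm_Cone|].
  rewrite Cnorm_mul, IH; ring.
Qed.

Lemma Rabs_Cre_le (z : Cplx) : (Rabs (Cre z) <= Cnorm z)%R.
Proof.
  rewrite <- sqrt_Rsqr_abs; apply sqrt_le_1_alt; unfold Cnorm2, Rsqr; nra.
Qed.

Lemma Rabs_Cim_le (z : Cplx) : (Rabs (Cim z) <= Cnorm z)%R.
Proof.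
  rewrite <- sqrt_Rsqr_abs; apply sqrt_le_1_alt; unfold Cnorm2, Rsqr; nra.
Qed.

Lemma Cnorm_le_components (z : Cplx) : (Cnorm z <= Rabs (Cre z) + Rabs (Cim z))%R.
Proof.
  replace z with (RtoC (Cre z) + (0, 1) * RtoC (Cim z)) at 1
    by (apply Cplx_eq; simpl; ring).
  eapply Rle_trans; [apply Cnorm_add|].
  rewrite Cnorm_mul, !Cnorm_RtoC.
  replace (Cnorm (0, 1)%R) with 1%R; [lra|].
  unfold Cnorm, Cnorm2; simpl; rewrite <- sqrt_1 at 1; f_equal; ring.
Qed.

Lemma Cnorm_Csum_le (f : nat -> Cplx) (c : R) (n : nat) :
  (forall i, (i <= n)%nat -> Cnorm (f i) <= c)%R ->
  (Cnorm (Csum f n) <= INR (S n) * c)%R.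
Proof.
  induction n as [|n IH]; intros H.
  - simpl; rewrite Rmult_1_l; apply H; lia.
  - change (Csum f (S n)) with (Csum f n + f (S n)); rewrite S_INR.
    eapply Rle_trans; [apply Cnorm_add|].
    specialize (IH ltac:(intros; apply H; lia)); specialize (H (S n) (Nat.le_refl _)); lra.
Qed.

(** [Cseries_to f l] is convertible with [Ccv (Csum f) l], so limit laws for sequences apply
    directly to series. *)
Definition Ccv (u : nat -> Cplx) (l : Cplx) : Prop :=
  Un_cv (fun n => Cre (u n)) (Cre l) /\ Un_cv (fun n => Cim (u n)) (Cim l).

Lemma Ccv_lim (u : nat -> Cplx) (l : Cplx) :
  Ccv u l <-> is_lim_seq (fun n => Cre (u n)) (Cre l) /\
              is_lim_seq (fun n => Cim (u n)) (Cim l).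
Proof. unfold Ccv; rewrite !is_lim_seq_Reals; reflexivity. Qed.

Lemma Ccv_ext (u v : nat -> Cplx) (l : Cplx) :
  (forall n, u n = v n) -> Ccv u l -> Ccv v l.
Proof.
  intros H; rewrite !Ccv_lim; intros [H1 H2]; split.
  - eapply is_lim_seq_ext; [|exact H1]; intros n; simpl; rewrite H; reflexivity.
  - eapply is_lim_seq_ext; [|exact H2]; intros n; simpl; rewrite H; reflexivity.
Qed.

Lemma Ccv_unique (u : nat -> Cplx) (l m : Cplx) : Ccv u l -> Ccv u m -> l = m.
Proof. intros [H1 H2] [H3 H4]; apply Cplx_eq; eapply UL_sequence; eassumption. Qed.

Lemma Ccv_add (u v : nat -> Cplx) (l m : Cplx) :
  Ccv u l -> Ccv v m -> Ccv (fun n => u n + v n) (l + m).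
Proof. intros [H1 H2] [H3 H4]; split; apply CV_plus; assumption. Qed.

Lemma Ccv_const (c : Cplx) : Ccv (fun _ => c) c.
Proof. apply Ccv_lim; split; apply is_lim_seq_const. Qed.

Lemma Ccv_mul (u v : nat -> Cplx) (l m : Cplx) :
  Ccv u l -> Ccv v m -> Ccv (fun n => u n * v n) (l * m).
Proof.
  intros [H1 H2] [H3 H4]; split.
  - apply CV_minus; apply CV_mult; assumption.
  - apply CV_plus; apply CV_mult; assumption.
Qed.

Lemma Ccv_scal (c : Cplx) (u : nat -> Cplx) (l : Cplx) :
  Ccv u l -> Ccv (fun n => c * u n) (c * l).
Proof. apply Ccv_mul, Ccv_const. Qed.

Lemma Ccv_sub (u v : nat -> Cplx) (l m : Cplx) :
  Ccv u l -> Ccv v m -> Ccv (fun n => u n - v n) (l - m).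
Proof. intros [H1 H2] [H3 H4]; split; apply CV_minus; assumption. Qed.

Lemma Ccv_shift (u : nat -> Cplx) (l : Cplx) : Ccv u l <-> Ccv (fun n => u (S n)) l.
Proof.
  rewrite !Ccv_lim, (is_lim_seq_incr_1 (fun n => Cre (u n))),
    (is_lim_seq_incr_1 (fun n => Cim (u n))); reflexivity.
Qed.

Lemma Ccv_zero (u : nat -> Cplx) (v : nat -> R) :
  (forall n, Cnorm (u n) <= v n)%R -> is_lim_seq v 0 -> Ccv u Czero.
Proof.
  intros H Hv; apply Ccv_lim.
  assert (H0 : forall w : nat -> R, (forall n, Rabs (w n) <= v n)%R -> is_lim_seq w 0).
  { intros w Hw; apply is_lim_seq_abs_0.
    apply is_lim_seq_le_le with (u := fun _ => 0%R) (w := v);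
      [|apply is_lim_seq_const | exact Hv].
    intros n; split; [apply Rabs_pos | apply Hw]. }
  split; apply H0; intros n; (eapply Rle_trans; [|apply H]);
    [apply Rabs_Cre_le | apply Rabs_Cim_le].
Qed.

(** The factor 2 comes from bounding the real and imaginary parts of the limit separately by [c];
    only geometric decay matters later. *)
Lemma Ccv_norm_le (u : nat -> Cplx) (l : Cplx) (c : R) :
  Ccv u l -> (forall n, Cnorm (u n) <= c)%R -> (Cnorm l <= 2 * c)%R.
Proof.
  rewrite Ccv_lim; intros [H1 H2] H.
  assert (H0 : forall (w : nat -> R) (m : R), is_lim_seq w m ->
    (forall n, Rabs (w n) <= c)%R -> (Rabs m <= c)%R).
  { intros w m Hw Hc; apply is_lim_seq_abs in Hw.
    exact (is_lim_seq_le _ _ _ _ Hc Hw (is_lim_seq_const c)). }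
  eapply Rle_trans; [apply Cnorm_le_components|].
  apply H0 in H1; [apply H0 in H2|].
  - lra.
  - intros n; eapply Rle_trans; [apply Rabs_Cim_le | apply H].
  - intros n; eapply Rle_trans; [apply Rabs_Cre_le | apply H].
Qed.

Lemma Cre_Csum (f : nat -> Cplx) (n : nat) :
  Cre (Csum f n) = sum_n (fun i => Cre (f i)) n.
Proof.
  induction n as [|n IH]; [now rewrite sum_O|].
  rewrite sum_Sn, <- IH; reflexivity.
Qed.

Lemma Cim_Csum (f : nat -> Cplx) (n : nat) :
  Cim (Csum f n) = sum_n (fun i => Cim (f i)) n.
Proof.
  induction n as [|n IH]; [now rewrite sum_O|].
  rewrite sum_Sn, <- IH; reflexivity.
Qed.

Lemma Cseries_to_is_series (f : nat -> Cplx) (l : Cplx) :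
  Cseries_to f l <-> is_series (fun n => Cre (f n)) (Cre l) /\
                     is_series (fun n => Cim (f n)) (Cim l).
Proof.
  change (Cseries_to f l) with (Ccv (Csum f) l); rewrite Ccv_lim.
  split; intros [H1 H2]; split.
  - eapply is_lim_seq_ext in H1; [exact H1 | intros n; apply Cre_Csum].
  - eapply is_lim_seq_ext in H2; [exact H2 | intros n; apply Cim_Csum].
  - eapply is_lim_seq_ext; [|exact H1]; intros n; symmetry; apply Cre_Csum.
  - eapply is_lim_seq_ext; [|exact H2]; intros n; symmetry; apply Cim_Csum.
Qed.

Lemma Cseries_to_scal (c : Cplx) (f : nat -> Cplx) (l : Cplx) :
  Cseries_to f l -> Cseries_to (fun n => c * f n) (c * l).
Proof.
  intros H; apply (Ccv_ext (fun n => c * Csum f n)).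
  - intros n; symmetry; apply Csum_scal.
  - apply Ccv_scal, H.
Qed.

Lemma Cseries_to_ext (f g : nat -> Cplx) (l : Cplx) :
  (forall n, f n = g n) -> Cseries_to f l -> Cseries_to g l.
Proof. intros H; apply Ccv_ext; intros n; apply Csum_ext; intros; apply H. Qed.

Lemma Cseries_geom_ex (f : nat -> Cplx) (c r : R) :
  (0 <= r < 1)%R -> (forall n, Cnorm (f n) <= c * r ^ n)%R ->
  exists l, Cseries_to f l.
Proof.
  intros Hr H.
  assert (Hg : ex_series (fun n => c * r ^ n)%R).
  { apply (@ex_series_scal_l R_AbsRing R_NormedModule c (fun n => r ^ n)%R).
    exists (/ (1 - r))%R; apply is_series_geom; rewrite Rabs_pos_eq; lra. }
  assert (H1 : ex_series (fun n => Cre (f n))).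
  { apply (ex_series_le (fun n => Cre (f n)) (fun n => c * r ^ n)%R); [|exact Hg].
    intros n; eapply Rle_trans; [apply Rabs_Cre_le | apply H]. }
  assert (H2 : ex_series (fun n => Cim (f n))).
  { apply (ex_series_le (fun n => Cim (f n)) (fun n => c * r ^ n)%R); [|exact Hg].
    intros n; eapply Rle_trans; [apply Rabs_Cim_le | apply H]. }
  destruct H1 as [l1 H1], H2 as [l2 H2].
  exists (l1, l2); apply Cseries_to_is_series; split; assumption.
Qed.

Lemma Csum_geom_le (f : nat -> Cplx) (c r : R) (N p : nat) :
  (0 <= r < 1)%R -> (forall n, Cnorm (f n) <= c * r ^ n)%R ->
  (Cnorm (Csum f (N + p) - Csum f N) <= c * r ^ S N / (1 - r))%R.
Proof.
  intros Hr H.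
  assert (Hc : (0 <= c)%R).
  { specialize (H 0%nat); pose proof (Cnorm_ge0 (f 0%nat)); simpl in H; lra. }
  assert (Hrn : forall n, (0 <= r ^ n)%R) by (intros; apply pow_le; lra).
  (* The exact geometric sum is needed for the induction on [p]; its negative term is dropped
     afterwards. *)
  assert (Hp : (Cnorm (Csum f (N + p) - Csum f N)
                <= c * (r ^ S N - r ^ S (N + p)) / (1 - r))%R).
  { induction p as [|p IH].
    - rewrite Nat.add_0_r.
      replace (Csum f N - Csum f N) with Czero by ring.
      rewrite Cnorm_Czero; right; field; lra.
    - rewrite Nat.add_succ_r.
      replace (Csum f (S (N + p)) - Csum f N)
        with (Csum f (N + p) - Csum f N + f (S (N + p))) by (simpl; ring).
      eapply Rle_trans; [apply Cnorm_add|].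
      eapply Rle_trans; [apply Rplus_le_compat; [exact IH | apply H]|].
      right; simpl; field; lra. }
  eapply Rle_trans; [exact Hp|].
  unfold Rdiv; apply Rmult_le_compat_r; [left; apply Rinv_0_lt_compat; lra|].
  apply Rmult_le_compat_l; [exact Hc|]; specialize (Hrn (S (N + p))); lra.
Qed.

Lemma Cseries_geom_tail (f : nat -> Cplx) (l : Cplx) (c r : R) (N : nat) :
  (0 <= r < 1)%R -> (forall n, Cnorm (f n) <= c * r ^ n)%R -> Cseries_to f l ->
  (Cnorm (l - Csum f N) <= 2 * (c * r ^ S N / (1 - r)))%R.
Proof.
  intros Hr H Hl.
  apply (Ccv_norm_le (fun p => Csum f (N + p) - Csum f N)).
  - apply Ccv_sub; [|apply Ccv_const].
    apply Ccv_lim in Hl; apply Ccv_lim; destruct Hl as [H1 H2].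
    apply (is_lim_seq_incr_n _ N) in H1; apply (is_lim_seq_incr_n _ N) in H2.
    split; [eapply is_lim_seq_ext; [|exact H1] | eapply is_lim_seq_ext; [|exact H2]];
      intros n; simpl; rewrite (Nat.add_comm n N); reflexivity.
  - intros p; apply Csum_geom_le; assumption.
Qed.

Lemma Cseries_geom_le (f : nat -> Cplx) (l : Cplx) (c r : R) :
  (0 <= r < 1)%R -> (forall n, Cnorm (f n) <= c * r ^ n)%R -> Cseries_to f l ->
  (Cnorm l <= 2 * (c / (1 - r)))%R.
Proof.
  intros Hr H Hl.
  assert (Hc : (0 <= c)%R).
  { specialize (H 0%nat); pose proof (Cnorm_ge0 (f 0%nat)); simpl in H; lra. }
  apply (Ccv_norm_le (Csum f) _ _ Hl); intros n.
  replace (Csum f n) with (f 0%nat + (Csum f (0 + n) - Csum f 0)) by (simpl; ring).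
  eapply Rle_trans; [apply Cnorm_add|].
  eapply Rle_trans; [apply Rplus_le_compat; [apply H | apply (Csum_geom_le f c r); assumption]|].
  right; simpl; field; lra.
Qed.

(** Collects the entries (m, l) of weight [2m + l = n]. The range is [m <= n], as in
    [hypergeom_coef_sum], and the guard removes the [m] for which [n - 2m] would truncate to 0. *)
Definition weighted_diag (e : nat -> nat -> Cplx) (n : nat) : Cplx :=
  Csum (fun m => if (2 * m <=? n)%nat then e m (n - 2 * m)%nat else Czero) n.

Lemma Csum_weighted_diag (e : nat -> nat -> Cplx) (N : nat) :
  Csum (weighted_diag e) N =
  Csum (fun m => if (2 * m <=? N)%nat then Csum (e m) (N - 2 * m) else Czero) N.
Proof.
  assert (HS : forall g n, Csum g (S n) = Csum g n + g (S n)) by reflexivity.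
  induction N as [|N IH]; [reflexivity|].
  assert (Hstep : Csum (fun m => if (2 * m <=? S N)%nat then Csum (e m) (S N - 2 * m)
                                 else Czero) N
    = Csum (fun m => if (2 * m <=? N)%nat then Csum (e m) (N - 2 * m) else Czero) N
      + Csum (fun m => if (2 * m <=? S N)%nat then e m (S N - 2 * m)%nat else Czero) N).
  { rewrite <- Csum_add; apply Csum_ext; intros m _.
    destruct (Nat.leb_spec (2 * m) N) as [H1|H1], (Nat.leb_spec (2 * m) (S N)) as [H2|H2];
      try lia.
    - replace (S N - 2 * m)%nat with (S (N - 2 * m)) by lia; reflexivity.
    - replace (S N - 2 * m)%nat with 0%nat by lia; simpl; ring.
    - ring. }
  rewrite HS, IH; unfold weighted_diag; rewrite !HS, Hstep.
  destruct (Nat.leb_spec (2 * S N) (S N)) as [Hlt|_]; [lia | ring].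
Qed.

(** Absorbs the number of rows in the Fubini argument at the price of a slower geometric rate. *)
Lemma INR_mul_pow4_le (n : nat) : (INR n * (/ 4) ^ n <= (/ 2) ^ n)%R.
Proof.
  replace (/ 4)%R with (/ 2 * / 2)%R by field; rewrite Rpow_mult_distr.
  assert (H : (INR n * (/ 2) ^ n <= 1)%R).
  { induction n as [|n IH]; [simpl; lra|].
    rewrite S_INR; simpl.
    assert ((/ 2) ^ n <= 1)%R.
    { rewrite <- (pow1 n); apply pow_incr; lra. }
    lra. }
  assert (0 < (/ 2) ^ n)%R by (apply pow_lt; lra); nra.
Qed.

(* A Fubini theorem for a doubly indexed family with a geometric majorant: rows
   truncated at total weight [N] miss [O (N * r ^ N)] of the sum of the first [N] rows. *)
Lemma Cseries_weighted_diag (e : nat -> nat -> Cplx) (E : nat -> Cplx) :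
  (forall m l, Cnorm (e m l) <= (/ 4) ^ (2 * m + l))%R ->
  (forall m, Cseries_to (e m) (E m)) ->
  exists S, Cseries_to E S /\ Cseries_to (weighted_diag e) S.
Proof.
  intros He HE.
  assert (Hgeom : forall m l, (Cnorm (e m l) <= (/ 4) ^ (2 * m) * (/ 4) ^ l)%R)
    by (intros m l; rewrite <- pow_add; apply He).
  assert (Hpos : forall n, (0 < (/ 4) ^ n)%R) by (intros; apply pow_lt; lra).
  assert (Hdec : forall i j, (i <= j)%nat -> ((/ 4) ^ j <= (/ 4) ^ i)%R).
  { intros i j Hij; replace j with (i + (j - i))%nat by lia; rewrite pow_add.
    assert ((/ 4) ^ (j - i) <= 1)%R
      by (rewrite <- (pow1 (j - i)); apply pow_incr; lra).
    specialize (Hpos i); nra. }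
  (* Here [8/3] is [2 / (1 - 1/4)], the 2 being that of [Ccv_norm_le]. *)
  assert (HEle : forall m, (Cnorm (E m) <= 8 / 3 * (/ 4) ^ (2 * m))%R).
  { intros m; eapply Rle_trans;
      [apply (Cseries_geom_le (e m) (E m) ((/ 4) ^ (2 * m)) (/ 4)); [lra | apply Hgeom | apply HE]|].
    right; field. }
  destruct (Cseries_geom_ex E (8 / 3) (/ 4)) as [S HS]; [lra| |].
  { intros m; eapply Rle_trans; [apply HEle|].
    apply Rmult_le_compat_l; [lra|]; apply Hdec; lia. }
  exists S; split; [exact HS|].
  apply (Ccv_ext (fun N => Csum E N - (Csum E N - Csum (weighted_diag e) N))).
  { intros N; ring. }
  replace S with (S - Czero) by ring.
  apply Ccv_sub; [exact HS|].
  apply (Ccv_zero _ (fun N => 8 / 3 * (/ 2) ^ Datatypes.S N)%R).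
  (* Each of the [N + 1] rows misses at most [8/3 * 4^-(N+1)]: a row with [2m <= N] misses a tail
     starting at weight [N + 1], and a row with [2m > N] is missing entirely but starts at weight at
     least [N + 1]. *)
  - intros N; rewrite Csum_weighted_diag, <- Csum_sub.
    eapply Rle_trans; [apply (Cnorm_Csum_le _ (8 / 3 * (/ 4) ^ Datatypes.S N)%R)|].
    + intros m Hm; destruct (Nat.leb_spec (2 * m) N) as [H|H].
      * eapply Rle_trans; [apply (Cseries_geom_tail (e m) (E m) ((/ 4) ^ (2 * m)) (/ 4));
          [lra | apply Hgeom | apply HE]|].
        replace (Datatypes.S N) with (2 * m + Datatypes.S (N - 2 * m))%nat by lia.
        rewrite pow_add; right; field.
      * replace (E m - Czero) with (E m) by ring.
        eapply Rle_trans; [apply HEle|].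
        apply Rmult_le_compat_l; [lra|]; apply Hdec; lia.
    + pose proof (INR_mul_pow4_le (Datatypes.S N)); lra.
  - apply (is_lim_seq_ext (fun N => 4 / 3 * (/ 2) ^ N)%R).
    { intros N; simpl; field. }
    replace (Finite 0) with (Rbar_mult (4 / 3)%R 0%R) by (simpl; f_equal; ring).
    apply is_lim_seq_scal_l, is_lim_seq_geom; rewrite Rabs_pos_eq; lra.
Qed.

(** * The binomial series *)

Definition Cderiv (f : R -> Cplx) (t : R) (d : Cplx) : Prop :=
  is_derive (fun s => Cre (f s)) t (Cre d) /\ is_derive (fun s => Cim (f s)) t (Cim d).

Ltac real_derive :=
  auto_derive;
  [ repeat split; try match goal with
    | H : is_derive _ ?x ?l |- ex_derive _ ?x => exists l; exact H
    end
  | repeat match goal with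
    | H : is_derive _ ?x ?l |- context [Derive ?f ?x] =>
        replace (Derive f x) with l by (symmetry; exact (is_derive_unique _ _ _ H))
    end ].

Lemma Cderiv_mul (f g : R -> Cplx) (t : R) (d e : Cplx) :
  Cderiv f t d -> Cderiv g t e ->
  Cderiv (fun s => f s * g s) t (d * g t + f t * e).
Proof.
  intros [Hf1 Hf2] [Hg1 Hg2].
  assert (H : forall (p q r s : R -> R) (p' q' r' s' : R),
    is_derive p t p' -> is_derive q t q' -> is_derive r t r' -> is_derive s t s' ->
    is_derive (fun x => p x * q x + r x * s x)%R t
      (p' * q t + p t * q' + (r' * s t + r t * s'))%R).
  { intros p q r s p' q' r' s' Hp Hq Hr Hs; real_derive; ring. }
  split; simpl.
  - replace (Cre d * Cre (g t) - Cim d * Cim (g t)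
             + (Cre (f t) * Cre e - Cim (f t) * Cim e))%R
      with (Cre d * Cre (g t) + Cre (f t) * Cre e
            + (Cim d * - Cim (g t) + Cim (f t) * - Cim e))%R by ring.
    apply (is_derive_ext (fun s => Cre (f s) * Cre (g s) + Cim (f s) * - Cim (g s))%R).
    + intros s; simpl; ring.
    + apply (H (fun s => Cre (f s)) (fun s => Cre (g s)) (fun s => Cim (f s))
               (fun s => - Cim (g s))%R); try assumption.
      apply (is_derive_opp (fun s => Cim (g s))); assumption.
  - replace (Cre d * Cim (g t) + Cim d * Cre (g t)
             + (Cre (f t) * Cim e + Cim (f t) * Cre e))%R
      with (Cre d * Cim (g t) + Cre (f t) * Cim e
            + (Cim d * Cre (g t) + Cim (f t) * Cre e))%R by ring.
    apply (H (fun s => Cre (f s)) (fun s => Cim (g s)) (fun s => Cim (f s))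
             (fun s => Cre (g s))); assumption.
Qed.

Lemma Cderiv_const (c : Cplx) (t : R) : Cderiv (fun _ => c) t Czero.
Proof. split; simpl; exact (is_derive_const _ t). Qed.

Lemma Cderiv_scal (c : Cplx) (f : R -> Cplx) (t : R) (d : Cplx) :
  Cderiv f t d -> Cderiv (fun s => c * f s) t (c * d).
Proof.
  intros H; replace (c * d) with (Czero * f t + c * d) by ring.
  apply Cderiv_mul; [apply Cderiv_const | exact H].
Qed.

Lemma Cderiv_exp (f : R -> Cplx) (t : R) (d : Cplx) :
  Cderiv f t d -> Cderiv (fun s => Cexp (f s)) t (Cexp (f t) * d).
Proof.
  assert (Hre : forall (p q : R -> R) (p' q' : R), is_derive p t p' -> is_derive q t q' ->
    is_derive (fun s => exp (p s) * cos (q s))%R t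
      (exp (p t) * cos (q t) * p' - exp (p t) * sin (q t) * q')%R)
    by (intros p q p' q' Hp Hq; real_derive; ring).
  assert (Him : forall (p q : R -> R) (p' q' : R), is_derive p t p' -> is_derive q t q' ->
    is_derive (fun s => exp (p s) * sin (q s))%R t
      (exp (p t) * cos (q t) * q' + exp (p t) * sin (q t) * p')%R)
    by (intros p q p' q' Hp Hq; real_derive; ring).
  intros [H1 H2]; split.
  - exact (Hre _ _ _ _ H1 H2).
  - exact (Him _ _ _ _ H1 H2).
Qed.

Lemma Cderiv_ln (f : R -> Cplx) (t : R) (d : Cplx) :
  (0 < Cre (f t))%R -> Cderiv f t d -> Cderiv (fun s => Cln (f s)) t (d / f t).
Proof.
  assert (Hre : forall (p q : R -> R) (p' q' : R), (0 < p t)%R ->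
    is_derive p t p' -> is_derive q t q' ->
    is_derive (fun s => ln (sqrt (p s * p s + q s * q s))) t
      (p' * (p t / (p t * p t + q t * q t)) - q' * (- q t / (p t * p t + q t * q t)))%R).
  { intros p q p' q' Hpos Hp Hq.
    assert (HN : (0 < p t * p t + q t * q t)%R) by nra.
    pose proof (sqrt_lt_R0 _ HN) as Hs.
    real_derive; try assumption.
    pose proof (sqrt_sqrt _ (Rlt_le _ _ HN)) as Hss.
    set (N := (p t * p t + q t * q t)%R) in *; set (s := sqrt N) in *.
    rewrite <- Hss; field; lra. }
  assert (Him : forall (p q : R -> R) (p' q' : R), (0 < p t)%R ->
    is_derive p t p' -> is_derive q t q' ->
    is_derive (fun s => atan (q s / p s)) t
      (p' * (- q t / (p t * p t + q t * q t)) + q' * (p t / (p t * p t + q t * q t)))%R).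
  { intros p q p' q' Hpos Hp Hq; real_derive; [lra|].
    field; split; [nra | lra]. }
  intros Hpos [H1 H2]; split.
  - exact (Hre _ _ _ _ Hpos H1 H2).
  (* By continuity the real part stays positive near [t], so [Carg] is locally its first branch. *)
  - refine (is_derive_ext_loc (fun s => atan (Cim (f s) / Cre (f s))) _ _ _ _
      (Him _ _ _ _ Hpos H1 H2)).
    assert (Hc : continuous (fun s => Cre (f s)) t)
      by (apply (ex_derive_continuous (fun s => Cre (f s))); eexists; exact H1).
    apply (filter_imp (fun s => (0 < Cre (f s))%R));
      [|exact (Hc (fun y => (0 < y)%R) (open_gt 0 _ Hpos))].
    intros s Hs; simpl; unfold Carg; destruct (Rlt_dec 0 (Cre (f s))); [reflexivity | contradiction].
Qed.

Lemma Cderiv_zero_const (f : R -> Cplx) (x y : R) :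
  (x < y)%R -> (forall t, (x <= t <= y)%R -> Cderiv f t Czero) -> f x = f y.
Proof.
  intros Hxy H; apply Cplx_eq.
  - apply (eq_is_derive (fun s => Cre (f s)) x y); [|exact Hxy].
    intros t Ht; exact (proj1 (H t Ht)).
  - apply (eq_is_derive (fun s => Cim (f s)) x y); [|exact Hxy].
    intros t Ht; exact (proj2 (H t Ht)).
Qed.

Definition CPSeries (u : nat -> Cplx) (t : R) : Cplx :=
  (PSeries (fun n => Cre (u n)) t, PSeries (fun n => Cim (u n)) t).

Definition CPS_derive (u : nat -> Cplx) (n : nat) : Cplx := NtoC (S n) * u (S n).

(** The rate 1/2 gives radius at least 2, so the endpoint [t = 1], where the binomial series is
    wanted, is an interior point and termwise differentiation is valid there. *)
Lemma CV_radius_geom (u : nat -> R) (t : R) :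
  (forall n, Rabs (u n) <= (/ 2) ^ n)%R -> (Rabs t <= 1)%R -> Rbar_lt (Rabs t) (CV_radius u).
Proof.
  intros H Ht; apply Rbar_lt_le_trans with 2%R; [simpl; lra|].
  apply (proj1 (CV_radius_bounded u)); exists 1%R; intros n.
  rewrite Rabs_mult, <- RPow_abs, (Rabs_pos_eq 2) by lra.
  replace 1%R with ((/ 2) ^ n * 2 ^ n)%R
    by (rewrite <- Rpow_mult_distr; replace (/ 2 * 2)%R with 1%R by field; apply pow1).
  apply Rmult_le_compat_r; [apply pow_le; lra | apply H].
Qed.

Lemma CV_radius_components (u : nat -> Cplx) (t : R) :
  (forall n, Cnorm (u n) <= (/ 2) ^ n)%R -> (Rabs t <= 1)%R ->
  Rbar_lt (Rabs t) (CV_radius (fun n => Cre (u n))) /\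
  Rbar_lt (Rabs t) (CV_radius (fun n => Cim (u n))).
Proof.
  intros Hu Ht; split; apply CV_radius_geom; try exact Ht; intros n;
    (eapply Rle_trans; [|apply Hu]); [apply Rabs_Cre_le | apply Rabs_Cim_le].
Qed.

Lemma is_series_PSeries (v : nat -> R) (t : R) :
  Rbar_lt (Rabs t) (CV_radius v) -> is_series (fun n => v n * t ^ n)%R (PSeries v t).
Proof. intros H; apply is_pseries_R, PSeries_correct, CV_radius_inside, H. Qed.

Lemma CPSeries_correct (u : nat -> Cplx) (t : R) :
  (forall n, Cnorm (u n) <= (/ 2) ^ n)%R -> (Rabs t <= 1)%R ->
  Cseries_to (fun n => u n * RtoC (t ^ n)) (CPSeries u t).
Proof.
  intros Hu Ht; destruct (CV_radius_components u t Hu Ht) as [radius_re radius_im].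
  apply Cseries_to_is_series; split.
  - eapply is_series_ext; [|apply is_series_PSeries, radius_re]; intros n; simpl; ring.
  - eapply is_series_ext; [|apply is_series_PSeries, radius_im]; intros n; simpl; ring.
Qed.

Lemma CPSeries_derive_correct (u : nat -> Cplx) (t : R) :
  (forall n, Cnorm (u n) <= (/ 2) ^ n)%R -> (Rabs t <= 1)%R ->
  Cseries_to (fun n => CPS_derive u n * RtoC (t ^ n)) (CPSeries (CPS_derive u) t).
Proof.
  intros Hu Ht; destruct (CV_radius_components u t Hu Ht) as [radius_re radius_im].
  apply Cseries_to_is_series; split.
  - eapply is_series_ext; [|apply is_series_PSeries]; [intros n; simpl; ring|].
    rewrite (CV_radius_ext _ (PS_derive (fun n => Cre (u n)))).
    + rewrite CV_radius_derive; exact radius_re.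
    + intros n; unfold PS_derive, CPS_derive, NtoC, RtoC; cbn [Cre Cim fst snd Cmul]; ring.
  - eapply is_series_ext; [|apply is_series_PSeries]; [intros n; simpl; ring|].
    rewrite (CV_radius_ext _ (PS_derive (fun n => Cim (u n)))).
    + rewrite CV_radius_derive; exact radius_im.
    + intros n; unfold PS_derive, CPS_derive, NtoC, RtoC; cbn [Cre Cim fst snd Cmul]; ring.
Qed.

Lemma Cderiv_CPSeries (u : nat -> Cplx) (t : R) :
  (forall n, Cnorm (u n) <= (/ 2) ^ n)%R -> (Rabs t <= 1)%R ->
  Cderiv (CPSeries u) t (CPSeries (CPS_derive u) t).
Proof.
  intros Hu Ht; destruct (CV_radius_components u t Hu Ht) as [radius_re radius_im].
  split.
  - change (is_derive (PSeries (fun n => Cre (u n))) t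
      (PSeries (fun n => Cre (CPS_derive u n)) t)).
    rewrite (PSeries_ext _ (PS_derive (fun n => Cre (u n)))).
    + apply is_derive_PSeries, radius_re.
    + intros n; unfold PS_derive, CPS_derive, NtoC, RtoC; cbn [Cre Cim fst snd Cmul]; ring.
  - change (is_derive (PSeries (fun n => Cim (u n))) t
      (PSeries (fun n => Cim (CPS_derive u n)) t)).
    rewrite (PSeries_ext _ (PS_derive (fun n => Cim (u n)))).
    + apply is_derive_PSeries, radius_im.
    + intros n; unfold PS_derive, CPS_derive, NtoC, RtoC; cbn [Cre Cim fst snd Cmul]; ring.
Qed.

(** The factor [a + p + i] has norm at most [(1 + |a|)(p + i + 1)], and the product of the
    [p + i + 1] over [i < l] is [(p+l)!/p!]. *)
Lemma Cnorm_poch_shift_le (a : Cplx) (p l : nat) :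
  (Cnorm (poch (a + NtoC p) l) * INR (fact p)
   <= (1 + Cnorm a) ^ l * INR (fact (p + l)))%R.
Proof.
  pose proof (Cnorm_ge0 a) as Ha.
  induction l as [|l IH].
  - simpl poch; rewrite Cnorm_Cone, Nat.add_0_r; simpl; lra.
  - rewrite poch_S, Cnorm_mul, Nat.add_succ_r.
    change (fact (S (p + l))) with (S (p + l) * fact (p + l))%nat.
    rewrite mult_INR, S_INR, plus_INR.
    assert (Hf : (Cnorm (a + NtoC p + NtoC l) <= (1 + Cnorm a) * (INR p + INR l + 1))%R).
    { eapply Rle_trans; [apply Cnorm_add|].
      eapply Rle_trans; [apply Rplus_le_compat_r, Cnorm_add|].
      rewrite !Cnorm_NtoC; pose proof (pos_INR p); pose proof (pos_INR l); nra. }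
    apply Rle_trans with
      ((1 + Cnorm a) ^ l * INR (fact (p + l)) * ((1 + Cnorm a) * (INR p + INR l + 1)))%R.
    + replace (Cnorm (poch (a + NtoC p) l) * Cnorm (a + NtoC p + NtoC l) * INR (fact p))%R
        with (Cnorm (poch (a + NtoC p) l) * INR (fact p) * Cnorm (a + NtoC p + NtoC l))%R
        by ring.
      apply Rmult_le_compat; [| apply Cnorm_ge0 | exact IH | exact Hf].
      apply Rmult_le_pos; [apply Cnorm_ge0 | apply pos_INR].
    + right; simpl; ring.
Qed.

(** A binomial coefficient is at most [2^(p+q)]; the induction is Pascal's rule cleared of
    denominators. *)
Lemma fact_add_le (p q : nat) : (fact (p + q) <= 2 ^ (p + q) * (fact p * fact q))%nat.
Proof.
  assert (H : forall n p q, (p + q = n)%nat ->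
    (fact (p + q) <= 2 ^ (p + q) * (fact p * fact q))%nat).
  { clear p q; induction n as [|n IH]; intros p q Hn.
    - replace p with 0%nat by lia; replace q with 0%nat by lia; simpl; lia.
    - destruct p as [|p]; [|destruct q as [|q]].
      + simpl (0 + q)%nat; pose proof (Nat.pow_nonzero 2 q); simpl (fact 0); nia.
      + rewrite Nat.add_0_r; pose proof (Nat.pow_nonzero 2 (S p)); simpl (fact 0); nia.
      + pose proof (IH p (S q) ltac:(lia)) as H1; pose proof (IH (S p) q ltac:(lia)) as H2.
        replace (p + S q)%nat with n in H1 by lia.
        replace (S p + q)%nat with n in H2 by lia.
        replace (S p + S q)%nat with (S n) by lia.
        assert (E : S n = (S p + S q)%nat) by lia.
        change (fact (S n)) with (S n * fact n)%nat; rewrite E at 1.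
        change (fact (S p)) with (S p * fact p)%nat in *.
        change (fact (S q)) with (S q * fact q)%nat in *.
        rewrite Nat.pow_succ_r'; nia. }
  apply (H _ p q eq_refl).
Qed.

Lemma fact_add_le_INR (p q : nat) :
  (INR (fact (p + q)) <= 2 ^ (p + q) * (INR (fact p) * INR (fact q)))%R.
Proof.
  rewrite <- !mult_INR.
  replace (2 ^ (p + q))%R with (INR (2 ^ (p + q))) by apply pow_INR.
  rewrite <- mult_INR; apply le_INR, fact_add_le.
Qed.

(** The growth rate in [l] does not depend on [p], so the series for all exponents [a + 3m] converge
    on one common disc. *)
Lemma Cnorm_binc_shift_le (a : Cplx) (p l : nat) :
  (Cnorm (binc (a + NtoC p) l) <= 2 ^ p * (2 * (1 + Cnorm a)) ^ l)%R.
Proof.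
  unfold binc; rewrite Cnorm_div, Cnorm_NtoC by apply NtoC_fact_neq0.
  pose proof (INR_fact_lt_0 p) as Hp; pose proof (INR_fact_lt_0 l) as Hl.
  apply (Rmult_le_reg_r (INR (fact p) * INR (fact l))); [apply Rmult_lt_0_compat; assumption|].
  replace (Cnorm (poch (a + NtoC p) l) / INR (fact l) * (INR (fact p) * INR (fact l)))%R
    with (Cnorm (poch (a + NtoC p) l) * INR (fact p))%R by (field; lra).
  eapply Rle_trans; [apply Cnorm_poch_shift_le|].
  apply Rle_trans with ((1 + Cnorm a) ^ l * (2 ^ (p + l) * (INR (fact p) * INR (fact l))))%R.
  - apply Rmult_le_compat_l; [|apply fact_add_le_INR].
    apply pow_le; pose proof (Cnorm_ge0 a); lra.
  - right; rewrite pow_add, Rpow_mult_distr; ring.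
Qed.

Lemma Cnorm_binc_le (a : Cplx) (l : nat) : (Cnorm (binc a l) <= (1 + Cnorm a) ^ l)%R.
Proof.
  unfold binc; rewrite Cnorm_div, Cnorm_NtoC by apply NtoC_fact_neq0.
  pose proof (INR_fact_lt_0 l) as Hl; pose proof (Cnorm_poch_shift_le a 0 l) as H.
  rewrite NtoC_0 in H; replace (a + Czero) with a in H by ring; simpl in H.
  apply (Rmult_le_reg_r (INR (fact l))); [exact Hl|].
  unfold Rdiv; rewrite Rmult_assoc, Rinv_l by lra; lra.
Qed.

Lemma Cexp_0 : Cexp Czero = Cone.
Proof. apply Cplx_eq; simpl; rewrite exp_0, ?cos_0, ?sin_0; ring. Qed.

Lemma Cln_1 : Cln Cone = Czero.
Proof.
  unfold Cln; rewrite Cnorm_Cone, ln_1; apply Cplx_eq; [reflexivity|].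
  unfold Carg; simpl; destruct (Rlt_dec 0 1); [|lra].
  replace (0 / 1)%R with 0%R by field; apply atan_0.
Qed.

(* Along the ray [t |-> t z], the product of the series and of [(1 - t z)^a] has zero
   derivative. *)
Lemma binomial_series (a z : Cplx) :
  ((1 + Cnorm a) * Cnorm z <= / 2)%R ->
  exists B, Cseries_to (fun n => binc a n * Cpown z n) B /\ Cpow (Cone - z) a * B = Cone.
Proof.
  intros Hz.
  pose proof (Cnorm_ge0 a) as Ha; pose proof (Cnorm_ge0 z) as Hz0.
  set (u := fun n => binc a n * Cpown z n).
  assert (Hu : forall n, (Cnorm (u n) <= (/ 2) ^ n)%R).
  { intros n; unfold u; rewrite Cnorm_mul, Cnorm_Cpown.
    apply Rle_trans with ((1 + Cnorm a) ^ n * Cnorm z ^ n)%R.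
    - apply Rmult_le_compat_r; [apply pow_le; assumption | apply Cnorm_binc_le].
    - rewrite <- Rpow_mult_distr; apply pow_incr; split; [nra | exact Hz]. }
  set (w := fun t => Cone - RtoC t * z).
  (* The hypothesis gives [|z| <= 1/2], which keeps the segment [1 - t z] in the right half-plane,
     away from the cut of [Cln]. *)
  assert (Hw : forall t, (0 <= t <= 1)%R -> (0 < Cre (w t))%R).
  { intros t Ht; unfold w; simpl.
    pose proof (Rabs_Cre_le z) as Hr; pose proof (Rle_abs (Cre z)); nra. }
  (* The equation [(1 - t z) F' = a z F] comes from the coefficient recurrence
     [(n+1) u_{n+1} = z (a+n) u_n], applied to partial sums and passed to the limit. *)
  assert (Hode : forall t, (0 <= t <= 1)%R ->
    w t * CPSeries (CPS_derive u) t = a * z * CPSeries u t).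
  { intros t Ht; assert (Ht' : (Rabs t <= 1)%R) by (rewrite Rabs_pos_eq; lra).
    pose proof (CPSeries_correct u t Hu Ht') as H0.
    pose proof (CPSeries_derive_correct u t Hu Ht') as H1.
    set (F := CPSeries u t) in *; set (F' := CPSeries (CPS_derive u) t) in *.
    set (P := Csum (fun n => u n * RtoC (t ^ n))) in *.
    set (P' := Csum (fun n => CPS_derive u n * RtoC (t ^ n))) in *.
    assert (Hrec : forall n, CPS_derive u n = z * ((a + NtoC n) * u n)).
    { intros n; unfold CPS_derive, u, binc.
      rewrite poch_S, NtoC_fact_S, NtoC_S; simpl Cpown; field; Cnz. }
    assert (HP : forall N, P' (S N) = a * z * P (S N) + z * (RtoC t * P' N)).
    { intros N; unfold P, P'.
      rewrite (Csum_ext _ (fun n => a * z * (u n * RtoC (t ^ n))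
                                    + z * (NtoC n * (u n * RtoC (t ^ n))))).
      - rewrite Csum_add, !Csum_scal, (Csum_S_l (fun n => NtoC n * _)), NtoC_0.
        rewrite (Csum_ext (fun n => NtoC (S n) * _)
          (fun n => RtoC t * (CPS_derive u n * RtoC (t ^ n)))).
        + rewrite Csum_scal; ring.
        + intros n _; unfold CPS_derive.
          replace (RtoC (t ^ S n)) with (RtoC t * RtoC (t ^ n))
            by (apply Cplx_eq; simpl; ring).
          ring.
      - intros n _; rewrite Hrec; ring. }
    assert (HF : F' = a * z * F + z * (RtoC t * F')).
    { apply (Ccv_unique (fun N => P' (S N))).
      - apply -> (Ccv_shift P'); exact H1.
      - apply (Ccv_ext (fun N => a * z * P (S N) + z * (RtoC t * P' N))).
        + intros N; rewrite HP; reflexivity.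
        + apply Ccv_add; apply Ccv_scal; [|apply Ccv_scal; exact H1].
          apply -> (Ccv_shift P); exact H0. }
    unfold w; transitivity (F' - z * (RtoC t * F')); [ring|].
    rewrite HF at 1; ring. }
  set (g := fun t => Cexp (a * Cln (w t)) * CPSeries u t).
  assert (Hg : forall t, (0 <= t <= 1)%R -> Cderiv g t Czero).
  { intros t Ht; assert (Ht' : (Rabs t <= 1)%R) by (rewrite Rabs_pos_eq; lra).
    assert (Hw0 : w t <> Czero).
    { intros E; specialize (Hw t Ht); rewrite E in Hw; simpl in Hw; lra. }
    assert (Hdw : Cderiv w t (- z)).
    { split; unfold w; simpl; auto_derive; trivial; ring. }
    replace Czero with (Cexp (a * Cln (w t)) * (a * (- z / w t)) * CPSeries u t
      + Cexp (a * Cln (w t)) * CPSeries (CPS_derive u) t).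
    - apply Cderiv_mul; [|apply Cderiv_CPSeries; assumption].
      apply Cderiv_exp, Cderiv_scal, Cderiv_ln; [apply Hw, Ht | exact Hdw].
    - replace (CPSeries (CPS_derive u) t) with (w t * CPSeries (CPS_derive u) t / w t)
        by (field; exact Hw0).
      rewrite Hode by exact Ht; field; exact Hw0. }
  exists (CPSeries u 1); split.
  - apply (Cseries_to_ext (fun n => u n * RtoC (1 ^ n))).
    + intros n; rewrite pow1; unfold u; change (RtoC 1) with Cone; ring.
    + apply CPSeries_correct; [exact Hu | rewrite Rabs_R1; lra].
  - transitivity (g 1%R).
    + unfold g, w, Cpow; do 5 f_equal; change (RtoC 1) with Cone; ring.
    + rewrite <- (Cderiv_zero_const g 0 1) by (lra || exact Hg).
      unfold g, w; replace (Cone - RtoC 0 * z) with Cone by (change (RtoC 0) with Czero; ring).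
      rewrite Cln_1; replace (a * Czero) with Czero by ring; rewrite Cexp_0.
      replace (CPSeries u 0) with (u 0%nat).
      * unfold u, binc; simpl; change (NtoC 1) with Cone; field; Cnz.
      * apply Cplx_eq; simpl; rewrite PSeries_0; reflexivity.
Qed.

(** Induction on [p]: by [binc_pred] the series for [a + p] is [1 - z] times the one for
    [a + p + 1]. The bound 1/8 makes [2 (1 + |a|) |z| <= 1/4], so every series converges
    geometrically. *)
Lemma binomial_series_shift (a z : Cplx) (p : nat) :
  ((1 + Cnorm a) * Cnorm z <= / 8)%R ->
  exists B, Cseries_to (fun n => binc (a + NtoC p) n * Cpown z n) B /\
            Cpow (Cone - z) a * Cpown (Cone - z) p * B = Cone.
Proof.
  intros Hz; pose proof (Cnorm_ge0 a) as Ha; pose proof (Cnorm_ge0 z) as Hz0.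
  assert (Hle : forall q n, (Cnorm (binc (a + NtoC q) n * Cpown z n) <= 2 ^ q * (/ 4) ^ n)%R).
  { intros q n; rewrite Cnorm_mul, Cnorm_Cpown.
    eapply Rle_trans; [apply Rmult_le_compat_r;
      [apply pow_le; assumption | apply Cnorm_binc_shift_le]|].
    rewrite Rmult_assoc, <- Rpow_mult_distr.
    apply Rmult_le_compat_l; [apply pow_le; lra|].
    apply pow_incr; split; [nra | lra]. }
  induction p as [|p [B [HB HBe]]].
  - destruct (binomial_series a z) as [B [HB HBe]]; [lra|].
    exists B; rewrite NtoC_0; replace (a + Czero) with a by ring; split; [exact HB|].
    simpl (Cpown _ 0); transitivity (Cpow (Cone - z) a * B); [ring | exact HBe].
  - destruct (Cseries_geom_ex _ (2 ^ S p) (/ 4) ltac:(lra) (Hle (S p))) as [B' HB'].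
    exists B'; split; [exact HB'|].
    assert (E : B = (Cone - z) * B').
    { apply (Ccv_unique (fun N => Csum (fun n => binc (a + NtoC p) n * Cpown z n) (S N))).
      - apply -> Ccv_shift; exact HB.
      - apply (Ccv_ext (fun N =>
          Csum (fun n => binc (a + NtoC (S p)) n * Cpown z n) (S N)
          - z * Csum (fun n => binc (a + NtoC (S p)) n * Cpown z n) N)).
        + intros N; rewrite !(Csum_S_l _ N), <- Csum_scal.
          match goal with |- ?x + ?y - ?v = _ => transitivity (x + (y - v)); [ring|] end.
          rewrite <- Csum_sub; f_equal; apply Csum_ext; intros n _.
          replace (a + NtoC p) with (a + NtoC (S p) - Cone) by (rewrite NtoC_S; ring).
          rewrite binc_pred; simpl Cpown; ring.
        + replace ((Cone - z) * B') with (B' - z * B') by ring.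
          apply Ccv_sub; [|apply Ccv_scal; exact HB'].
          apply -> (Ccv_shift (Csum (fun n => binc (a + NtoC (S p)) n * Cpown z n))); exact HB'. }
    transitivity (Cpow (Cone - z) a * Cpown (Cone - z) p * B); [|exact HBe].
    rewrite E; simpl; ring.
Qed.


(** * The double series *)

(** Finitely many of the [b + i] are handled one by one, being nonzero. For the others
    [|b + i| >= i - |b| >= (i+1)/2] as soon as [i >= 2|b| + 1]. This yields
    [|(b)_m| >= delta^m m!]. *)
Lemma not_nonpos_int_lower_bound (b : Cplx) : not_nonpos_int b ->
  exists delta : R, (0 < delta)%R /\ forall i, (delta * INR (S i) <= Cnorm (b + NtoC i))%R.
Proof.
  intros Hb.
  assert (Hfin : forall N, exists delta : R, (0 < delta)%R /\
    forall i, (i < N)%nat -> (delta * INR (S i) <= Cnorm (b + NtoC i))%R).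
  { induction N as [|N [delta [Hd IH]]].
    - exists 1%R; split; [lra | intros i Hi; lia].
    - pose proof (Cnorm_gt0 _ (not_nonpos_int_add b N Hb)) as HN.
      pose proof (lt_0_INR (S N) ltac:(lia)) as HSN.
      exists (Rmin delta (Cnorm (b + NtoC N) / INR (S N))); split.
      + apply Rmin_pos; [exact Hd | apply Rdiv_lt_0_compat; assumption].
      + intros i Hi; destruct (Nat.eq_dec i N) as [->|HiN].
        * apply Rle_trans with (Cnorm (b + NtoC N) / INR (S N) * INR (S N))%R.
          -- apply Rmult_le_compat_r; [lra | apply Rmin_r].
          -- right; field; lra.
        * eapply Rle_trans; [|apply IH; lia].
          apply Rmult_le_compat_r; [apply pos_INR | apply Rmin_l]. }
  destruct (INR_unbounded (2 * Cnorm b + 1)) as [N HN].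
  destruct (Hfin N) as [delta [Hd Hsmall]].
  exists (Rmin delta (/ 2)); split; [apply Rmin_pos; lra|].
  intros i; pose proof (pos_INR (S i)) as HSi.
  destruct (le_lt_dec N i) as [Hi|Hi].
  - apply Rle_trans with (/ 2 * INR (S i))%R; [apply Rmult_le_compat_r; [lra | apply Rmin_r]|].
    apply le_INR in Hi; rewrite S_INR.
    assert (H : (INR i <= Cnorm (b + NtoC i) + Cnorm b)%R).
    { rewrite <- (Cnorm_NtoC i), <- (Cnorm_opp b).
      replace (NtoC i) with (b + NtoC i + - b) at 1 by ring; apply Cnorm_add. }
    lra.
  - eapply Rle_trans; [|apply Hsmall, Hi].
    apply Rmult_le_compat_r; [exact HSi | apply Rmin_l].
Qed.

Lemma Cnorm_poch_ge (b : Cplx) (delta : R) (m : nat) : (0 < delta)%R ->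
  (forall i, (delta * INR (S i) <= Cnorm (b + NtoC i))%R) ->
  (delta ^ m * INR (fact m) <= Cnorm (poch b m))%R.
Proof.
  intros Hd H; induction m as [|m IH].
  - simpl poch; rewrite Cnorm_Cone; simpl; lra.
  - rewrite poch_S, Cnorm_mul; change (fact (S m)) with (S m * fact m)%nat.
    rewrite mult_INR.
    replace (delta ^ S m * (INR (S m) * INR (fact m)))%R
      with (delta ^ m * INR (fact m) * (delta * INR (S m)))%R by (simpl; ring).
    apply Rmult_le_compat; auto.
    + apply Rmult_le_pos; [apply pow_le; lra | apply pos_INR].
    + apply Rmult_le_pos; [lra | apply pos_INR].
Qed.

(** Splitting [3m + l], then [3m], then [2m] costs powers of 2 with exponents [3m + l], [3m] and
    [2m], in total [8m + l]. *)
Lemma fact_multinomial_le (m l : nat) :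
  (INR (fact (3 * m + l)) <= 2 ^ (8 * m + l) * (INR (fact m) ^ 3 * INR (fact l)))%R.
Proof.
  pose proof (INR_fact_lt_0 m) as Hm; pose proof (INR_fact_lt_0 l) as Hl.
  assert (Hp : forall n, (0 < 2 ^ n)%R) by (intros; apply pow_lt; lra).
  pose proof (fact_add_le_INR (3 * m) l) as H1.
  pose proof (fact_add_le_INR (2 * m) m) as H2.
  pose proof (fact_add_le_INR m m) as H3.
  replace (2 * m + m)%nat with (3 * m)%nat in H2 by lia.
  replace (m + m)%nat with (2 * m)%nat in H3 by lia.
  eapply Rle_trans; [exact H1|].
  apply Rle_trans with (2 ^ (3 * m + l) * (2 ^ (3 * m) *
    (2 ^ (2 * m) * (INR (fact m) * INR (fact m)) * INR (fact m)) * INR (fact l)))%R.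
  - apply Rmult_le_compat_l; [left; apply Hp|].
    apply Rmult_le_compat_r; [lra|].
    eapply Rle_trans; [exact H2|].
    apply Rmult_le_compat_l; [left; apply Hp|].
    apply Rmult_le_compat_r; [lra | exact H3].
  - right; replace (8 * m + l)%nat with ((3 * m + l) + (3 * m + 2 * m))%nat by lia.
    rewrite (pow_add 2 (3 * m + l) (3 * m + 2 * m)), (pow_add 2 (3 * m) (2 * m)); ring.
Qed.

(* The left-hand side divided by [(1 - x/4)^a], with [(1 - x/4)^(-a-3m)] expanded
   by the binomial series: the total degree in [x] is [2 m + l]. *)
Definition expanded_term (a b1 b2 x : Cplx) (m l : nat) : Cplx :=
  poch a (3 * m + l) * Cpown x (2 * m + l)
  / (NtoC (fact m) * poch b1 m * poch b2 m * NtoC (fact l) * Cpown (RtoC 4) (3 * m + l)).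

Lemma expanded_term_factor (a b1 b2 x : Cplx) (m l : nat) :
  not_nonpos_int b1 -> not_nonpos_int b2 ->
  expanded_term a b1 b2 x m l =
  poch a (3 * m) * Cpown x (2 * m)
    / (NtoC (fact m) * poch b1 m * poch b2 m * Cpown (RtoC 4) (3 * m))
  * (binc (a + NtoC (3 * m)) l * Cpown (x / RtoC 4) l).
Proof.
  intros H1 H2; unfold expanded_term, binc.
  assert (H4 : forall n, Cpown (RtoC 4) n <> Czero) by (intros; apply Cpown_neq0; Cnz).
  assert (Hdiv : Cpown (x / RtoC 4) l = Cpown x l / Cpown (RtoC 4) l).
  { replace (Cpown x l) with (Cpown (x / RtoC 4 * RtoC 4) l)
      by (f_equal; field; Cnz).
    rewrite Cpown_mul_base; field; apply H4. }
  rewrite Hdiv, poch_add, !Cpown_add.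
  pose proof (poch_neq0 b1 m H1); pose proof (poch_neq0 b2 m H2).
  field; Cnz; apply H4.
Qed.

(** The numerator grows like [(3m+l)!] and the denominator like [m!^3 l!], so the factorials cancel
    up to powers and leave [(4 K^3 |x|^2 / d^2)^m (K |x| / 2)^l]. *)
Lemma Cnorm_expanded_term_le (a b1 b2 : Cplx) :
  not_nonpos_int b1 -> not_nonpos_int b2 ->
  exists eps : R, (0 < eps)%R /\ forall x, (Cnorm x < eps)%R ->
    forall m l, (Cnorm (expanded_term a b1 b2 x m l) <= (/ 4) ^ (2 * m + l))%R.
Proof.
  intros H1 H2.
  destruct (not_nonpos_int_lower_bound b1 H1) as [d1 [Hd1 Hb1]].
  destruct (not_nonpos_int_lower_bound b2 H2) as [d2 [Hd2 Hb2]].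
  set (d := Rmin d1 d2).
  assert (Hd : (0 < d)%R) by (apply Rmin_pos; assumption).
  set (K := (1 + Cnorm a)%R).
  assert (HK : (1 <= K)%R) by (unfold K; pose proof (Cnorm_ge0 a); lra).
  (* From [Rr |x| <= 1] the first summand gives [K |x| / 2 <= 1/4]; the second gives
     [2 K^2 |x| / d <= 1/4], whose square bounds [4 K^3 |x|^2 / d^2] because [K >= 1]. *)
  set (Rr := (2 * K + 8 * K * K / d)%R).
  assert (HKd : (0 < K * K / d)%R) by (apply Rdiv_lt_0_compat; nra).
  assert (HR : (0 < Rr)%R) by (unfold Rr, Rdiv in *; nra).
  exists (/ Rr)%R; split; [apply Rinv_0_lt_compat, HR|].
  intros x Hx m l.
  pose proof (Cnorm_ge0 x) as Hx0.
  assert (HRx : (Rr * Cnorm x <= 1)%R).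
  { rewrite <- (Rinv_r Rr) by lra; apply Rmult_le_compat_l; lra. }
  assert (Hpoch : forall b d', (0 < d')%R -> (d <= d')%R ->
    (forall i, (d' * INR (S i) <= Cnorm (b + NtoC i))%R) ->
    (d ^ m * INR (fact m) <= Cnorm (poch b m))%R).
  { intros b d' Hd' Hdd Hb; eapply Rle_trans; [|apply (Cnorm_poch_ge b d'); assumption].
    apply Rmult_le_compat_r; [apply pos_INR | apply pow_incr; lra]. }
  pose proof (Hpoch b1 d1 Hd1 (Rmin_l _ _) Hb1) as Hp1.
  pose proof (Hpoch b2 d2 Hd2 (Rmin_r _ _) Hb2) as Hp2.
  pose proof (INR_fact_lt_0 m) as Hm; pose proof (INR_fact_lt_0 l) as Hl.
  assert (Hdm : (0 < d ^ m)%R) by (apply pow_lt, Hd).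
  assert (Hnum : (Cnorm (poch a (3 * m + l)) <=
    K ^ (3 * m + l) * (2 ^ (8 * m + l) * (INR (fact m) ^ 3 * INR (fact l))))%R).
  { pose proof (Cnorm_poch_shift_le a 0 (3 * m + l)) as H.
    rewrite NtoC_0 in H; replace (a + Czero) with a in H by ring.
    simpl (fact 0) in H; rewrite INR_1, Rmult_1_r in H.
    eapply Rle_trans; [exact H|]; simpl (0 + (3 * m + l))%nat; fold K.
    apply Rmult_le_compat_l; [apply pow_le; lra | apply fact_multinomial_le]. }
  unfold expanded_term; rewrite Cnorm_div.
  2: { pose proof (poch_neq0 b1 m H1); pose proof (poch_neq0 b2 m H2).
       Cnz; apply Cpown_neq0; Cnz. }
  rewrite !Cnorm_mul, !Cnorm_Cpown, !Cnorm_NtoC, Cnorm_RtoC, (Rabs_pos_eq 4) by lra.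
  set (P1 := Cnorm (poch b1 m)) in *; set (P2 := Cnorm (poch b2 m)) in *.
  assert (Hq : (0 < d ^ m * INR (fact m))%R) by (apply Rmult_lt_0_compat; assumption).
  assert (H4 : (0 < 4 ^ (3 * m + l))%R) by (apply pow_lt; lra).
  set (D := (INR (fact m) * (d ^ m * INR (fact m)) * (d ^ m * INR (fact m))
             * INR (fact l) * 4 ^ (3 * m + l))%R).
  assert (HD : (0 < D)%R) by (unfold D; repeat apply Rmult_lt_0_compat; assumption).
  assert (HDle : (D <= INR (fact m) * P1 * P2 * INR (fact l) * 4 ^ (3 * m + l))%R).
  { unfold D; apply Rmult_le_compat_r; [lra|]; apply Rmult_le_compat_r; [lra|].
    apply Rmult_le_compat; try lra; [nra|]; apply Rmult_le_compat_l; lra. }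
  apply Rle_trans with (K ^ (3 * m + l) * (2 ^ (8 * m + l) * (INR (fact m) ^ 3 * INR (fact l)))
    * Cnorm x ^ (2 * m + l) / D)%R.
  { unfold Rdiv; apply Rmult_le_compat.
    - apply Rmult_le_pos; [apply Cnorm_ge0 | apply pow_le, Hx0].
    - left; apply Rinv_0_lt_compat; lra.
    - apply Rmult_le_compat_r; [apply pow_le, Hx0 | exact Hnum].
    - apply Rinv_le_contravar; assumption. }
  apply Rle_trans with ((4 * K ^ 3 / (d * d) * Cnorm x ^ 2) ^ m * (K * Cnorm x / 2) ^ l)%R.
  { right; unfold D.
    replace (4 ^ (3 * m + l))%R with (2 ^ (6 * m + 2 * l))%R
      by (replace (6 * m + 2 * l)%nat with (2 * (3 * m + l))%nat by lia;
          rewrite pow_mult; f_equal; ring).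
    replace (2 ^ (8 * m + l))%R with (4 ^ m * 2 ^ (6 * m + l))%R
      by (replace (8 * m + l)%nat with (2 * m + (6 * m + l))%nat by lia;
          rewrite (pow_add 2 (2 * m)), (pow_mult 2 2 m); do 2 f_equal; ring).
    replace (2 ^ (6 * m + 2 * l))%R with (2 ^ (6 * m + l) * 2 ^ l)%R
      by (rewrite <- pow_add; f_equal; lia).
    unfold Rdiv.
    rewrite !Rpow_mult_distr, !pow_add, <- !pow_mult, !pow_inv, !Rpow_mult_distr.
    assert (0 < 2 ^ (6 * m))%R by (apply pow_lt; lra).
    assert (0 < 2 ^ l)%R by (apply pow_lt; lra).
    field; lra. }
  rewrite pow_add, pow_mult.
  apply Rmult_le_compat.
  - apply pow_le; apply Rmult_le_pos; [|apply pow_le, Hx0].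
    left; apply Rdiv_lt_0_compat; [|nra].
    apply Rmult_lt_0_compat; [lra | apply pow_lt; lra].
  - apply pow_le; unfold Rdiv; nra.
  - apply pow_incr; split.
    + apply Rmult_le_pos; [|apply pow_le, Hx0].
      left; apply Rdiv_lt_0_compat; [|nra].
      apply Rmult_lt_0_compat; [lra | apply pow_lt; lra].
    + assert (Hs : (8 * (K * K / d) * Cnorm x <= 1)%R)
        by (unfold Rr, Rdiv in *; nra).
      assert (Hs0 : (0 <= K * K / d * Cnorm x)%R) by (apply Rmult_le_pos; lra).
      apply Rle_trans with ((2 * (K * K / d * Cnorm x)) ^ 2)%R.
      * replace ((2 * (K * K / d * Cnorm x)) ^ 2)%R
          with (4 * (K ^ 3 * K) / (d * d) * Cnorm x ^ 2)%R by (field; lra).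
        apply Rmult_le_compat_r; [apply pow_le, Hx0|].
        unfold Rdiv; apply Rmult_le_compat_r; [left; apply Rinv_0_lt_compat; nra|].
        pose proof (pow_le K 3 ltac:(lra)); nra.
      * apply pow_incr; lra.
  - apply pow_incr; split; [unfold Rdiv; nra|].
    unfold Rr in HRx; unfold Rdiv in *; nra.
Qed.

(** * Identification of both sides with the double series *)

Lemma poch_triple (a : Cplx) (m : nat) :
  poch (third * a) m * poch (third + third * a) m * poch (RtoC (2 / 3) + third * a) m
  * Cpown (RtoC 27) m = poch a (3 * m).
Proof.
  assert (H3 : third = Cone / RtoC 3) by (apply RtoC_div; lra).
  assert (H23 : RtoC (2 / 3) = RtoC 2 / RtoC 3) by (apply RtoC_div; lra).
  induction m as [|m IH].
  - simpl; ring.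
  - replace (3 * S m)%nat with (S (S (S (3 * m)))) by lia.
    rewrite !(poch_S a), <- IH, !poch_S, !NtoC_S, NtoC_mul; simpl Cpown.
    replace (NtoC 3) with (RtoC 3) by (unfold NtoC; f_equal; simpl; ring).
    generalize (poch (third * a) m) (poch (third + third * a) m)
      (poch (RtoC (2 / 3) + third * a) m); intros p q r.
    rewrite H3, H23; field; Cnz.
Qed.

(** The 27 in the argument completes the triplication formula for [(a)_{3m}], and [(1 - x/4)^(3m)]
    cancels [(4 - x)^(3m)] up to [4^(3m)]. The result is the factor of [expanded_term] that does not
    depend on [l]. *)
Lemma LHS_term_eq (k : nat) (a b x : Cplx) (m : nat) :
  not_nonpos_int (Lb1 k a b) -> not_nonpos_int (Lb2 k a b) -> RtoC 4 - x <> Czero ->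
  LHS_term k a b x m * Cpown (Cone - x / RtoC 4) (3 * m) =
  poch a (3 * m) * Cpown x (2 * m)
    / (NtoC (fact m) * poch (Lb1 k a b) m * poch (Lb2 k a b) m * Cpown (RtoC 4) (3 * m)).
Proof.
  intros H1 H2 Hx; unfold LHS_term, F32_term.
  assert (Hy : Cpown (RtoC 4 - x) (3 * m) <> Czero) by (apply Cpown_neq0, Hx).
  assert (H4 : Cpown (RtoC 4) (3 * m) <> Czero) by (apply Cpown_neq0; Cnz).
  assert (Hz : Cpown (RtoC 27 * (x * x) / Cpown (RtoC 4 - x) 3) m * Cpown (RtoC 4 - x) (3 * m)
               = Cpown (RtoC 27) m * Cpown x (2 * m)).
  { rewrite !(Cpown_mul _ _ m), <- !Cpown_mul_base; f_equal; simpl; field; Cnz. }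
  assert (Hw : Cpown (Cone - x / RtoC 4) (3 * m) * Cpown (RtoC 4) (3 * m)
               = Cpown (RtoC 4 - x) (3 * m)).
  { rewrite <- Cpown_mul_base; f_equal; field; Cnz. }
  rewrite <- poch_triple.
  pose proof (poch_neq0 _ m H1); pose proof (poch_neq0 _ m H2).
  set (P := poch (third * a) m * poch (third + third * a) m * poch (RtoC (2 / 3) + third * a) m).
  set (z := Cpown (RtoC 27 * (x * x) / Cpown (RtoC 4 - x) 3) m) in *.
  set (w := Cpown (Cone - x / RtoC 4) (3 * m)) in *.
  set (D := NtoC (fact m) * poch (Lb1 k a b) m * poch (Lb2 k a b) m).
  assert (HD : D <> Czero) by (unfold D; Cnz).
  transitivity (P * (z * (w * Cpown (RtoC 4) (3 * m))) / (D * Cpown (RtoC 4) (3 * m))).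
  - field; Cnz.
  - rewrite Hw, Hz; field; Cnz.
Qed.

Lemma RHS_term_eq (k : nat) (a b x : Cplx) (n : nat) :
  not_nonpos_int (Lb1 k a b) -> not_nonpos_int (Lb2 k a b) ->
  not_nonpos_int (Rc1 k a b) -> not_nonpos_int (Rc2 k a b) ->
  poch (Cu k a b) k <> Czero -> poch (Cv k a b) k <> Czero ->
  RHS_term k a b x n = weighted_diag (expanded_term a (Lb1 k a b) (Lb2 k a b) x) n.
Proof.
  intros H1 H2 H3 H4 Hu Hv.
  assert (H34 : RtoC (3 / 4) = RtoC 3 / RtoC 4) by (apply RtoC_div; lra).
  assert (H14 : RtoC (1 / 4) = Cone / RtoC 4) by (apply RtoC_div; lra).
  set (c := Rp2 k a b + NtoC k); set (d := Rp1 k a b + NtoC k).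
  assert (Eb1 : Lb1 k a b = c + half)
    by (unfold c, Lb1, Rp2; rewrite H34, H14, half_eq; field; Cnz).
  assert (Eb2 : Lb2 k a b = d + half)
    by (unfold d, Lb2, Rp1; rewrite H34, H14, half_eq; field; Cnz).
  assert (Ec1 : Rc1 k a b = RtoC 2 * c)
    by (unfold c, Rc1, Rp2; rewrite H14, half_eq; field; Cnz).
  assert (Ec2 : Rc2 k a b = RtoC 2 * d)
    by (unfold d, Rc2, Rp1; rewrite H14, half_eq; field; Cnz).
  assert (Ea : a + NtoC n = c + d - half + NtoC n - NtoC k)
    by (unfold c, d, Rp1, Rp2; rewrite H14, half_eq; field; Cnz).
  pose proof (poch_neq0 _ n H3) as Hc1; pose proof (poch_neq0 _ n H4) as Hc2.
  assert (H4n : forall i, Cpown (RtoC 4) i <> Czero) by (intros; apply Cpown_neq0; Cnz).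
  transitivity (poch a n * Cpown x n
    / (NtoC (fact n) * poch (Rc1 k a b) n * poch (Rc2 k a b) n)
    * (poch (Rp1 k a b) n * poch (Rp2 k a b) n * Q3 k a b n)).
  { unfold RHS_term; field; Cnz. }
  rewrite Q3_eq by assumption; fold c d.
  rewrite (Csum_ext _ (fun j => half_poch n j * binc (- NtoC k) j
                                * (poch c (n - j) * poch d (n - j)))) by (intros; ring).
  rewrite Eb1, Eb2, Ec1, Ec2 in *.
  match goal with |- _ * ?S = _ =>
    transitivity (poch a n * Cpown x n / (NtoC (fact n) * Cpown (RtoC 4) n)
      * (Cpown (RtoC 4) n / (poch (RtoC 2 * c) n * poch (RtoC 2 * d) n) * S)) end.
  { field; Cnz; apply H4n. }
  rewrite <- hypergeom_coef_sum, <- Csum_scal by assumption; unfold weighted_diag.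
  apply Csum_ext; intros m Hm; rewrite <- Ea.
  pose proof (poch_neq0 _ m H1) as Hb1; pose proof (poch_neq0 _ m H2) as Hb2.
  destruct (Nat.leb_spec (2 * m) n) as [Hmn|Hmn].
  - unfold expanded_term.
    (* At weight [n] the Pochhammer symbol is [(a)_{n+m} = (a)_n (a+n)_m], and [half_poch_falling]
       trades [(n-2m)!] for [n!]. *)
    replace (3 * m + (n - 2 * m))%nat with (n + m)%nat by lia.
    replace (2 * m + (n - 2 * m))%nat with n by lia.
    rewrite poch_add, Cpown_add.
    pose proof (half_poch_falling n m Hmn) as Hf.
    assert (Hhp : half_poch n m <> Czero).
    { intros E; apply (NtoC_fact_neq0 n); rewrite <- Hf, E; ring. }
    rewrite <- Hf; field; Cnz; apply H4n.
  - rewrite half_poch_eq0 by easy; unfold Cdiv; ring.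
Qed.

Theorem theorem3 (k : nat) (a b : Cplx)
  (hb1 : not_nonpos_int (Lb1 k a b))
  (hb2 : not_nonpos_int (Lb2 k a b))
  (hc1 : not_nonpos_int (Rc1 k a b))
  (hc2 : not_nonpos_int (Rc2 k a b))
  (hu : poch (Cu k a b) k <> Czero)
  (hv : poch (Cv k a b) k <> Czero) :
  exists eps : R, 0 < eps /\
    forall x : Cplx, Cnorm x < eps ->
      exists L M : Cplx,
        Cseries_to (LHS_term k a b x) L /\
        Cseries_to (RHS_term k a b x) M /\
        L = Cmul (Cpow (Csub Cone (Cdiv x (RtoC 4))) a) M.
Proof.
  destruct (Cnorm_expanded_term_le a _ _ hb1 hb2) as [eps1 [Heps1 Hmaj]].
  pose proof (Cnorm_ge0 a) as Ha.
  (* The second bound gives [(1 + |a|) |x/4| <= 1/8], as [binomial_series_shift] requires, and also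
     excludes [x = 4]. *)
  exists (Rmin eps1 (/ (2 * (1 + Cnorm a)))); split.
  { apply Rmin_pos; [exact Heps1 | apply Rinv_0_lt_compat; lra]. }
  intros x Hx.
  assert (Hx1 : (Cnorm x < eps1)%R) by (eapply Rlt_le_trans; [exact Hx | apply Rmin_l]).
  assert (Hx2 : ((1 + Cnorm a) * Cnorm x <= / 2)%R).
  { assert (H : (Cnorm x < / (2 * (1 + Cnorm a)))%R)
      by (eapply Rlt_le_trans; [exact Hx | apply Rmin_r]).
    replace (/ 2)%R with ((1 + Cnorm a) * / (2 * (1 + Cnorm a)))%R by (field; lra).
    apply Rmult_le_compat_l; lra. }
  pose proof (Cnorm_ge0 x) as Hx0.
  set (w := Cone - x / RtoC 4).
  assert (Hx4 : RtoC 4 - x <> Czero).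
  { intros E; assert (E' : x = RtoC 4) by (replace x with (RtoC 4 - (RtoC 4 - x)) by ring;
      rewrite E; ring).
    rewrite E', Cnorm_RtoC, Rabs_pos_eq in Hx2 by lra; nra. }
  assert (Hw : w <> Czero).
  { intros E; apply Hx4; replace (RtoC 4 - x) with (RtoC 4 * w) by (unfold w; field; Cnz).
    rewrite E; ring. }
  assert (Hrow : forall m, exists E,
    Cseries_to (expanded_term a (Lb1 k a b) (Lb2 k a b) x m) E /\
    LHS_term k a b x m = Cpow w a * E).
  { intros m; destruct (binomial_series_shift a (x / RtoC 4) (3 * m)) as [B [HB HBe]].
    { rewrite Cnorm_div, Cnorm_RtoC, (Rabs_pos_eq 4) by (lra || Cnz); lra. }
    exists (LHS_term k a b x m * Cpown w (3 * m) * B); split.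
    - apply (Cseries_to_ext (fun l => LHS_term k a b x m * Cpown w (3 * m)
        * (binc (a + NtoC (3 * m)) l * Cpown (x / RtoC 4) l))).
      + intros l; unfold w; rewrite LHS_term_eq, expanded_term_factor by assumption.
        reflexivity.
      + apply Cseries_to_scal, HB.
    - fold w in HBe.
      transitivity (LHS_term k a b x m * (Cpow w a * Cpown w (3 * m) * B)); [|ring].
      rewrite HBe; ring. }
  (* [Hrow] only asserts that each row sum exists; the division defines them as a function of [m]
     without choice. *)
  set (E := fun m => LHS_term k a b x m / Cpow w a).
  (* The binomial sum with [p = 0] is an inverse of [Cpow w a]. *)
  assert (Hwa : Cpow w a <> Czero).
  { destruct (binomial_series_shift a (x / RtoC 4) 0) as [B [_ HBe]].
    { rewrite Cnorm_div, Cnorm_RtoC, (Rabs_pos_eq 4) by (lra || Cnz); lra. }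
    fold w in HBe; intros E0; apply (RtoC_neq0 1); [lra|].
    change (RtoC 1) with Cone; rewrite <- HBe, E0; ring. }
  destruct (Cseries_weighted_diag (expanded_term a (Lb1 k a b) (Lb2 k a b) x) E)
    as [S [HE HS]].
  - intros m l; apply Hmaj, Hx1.
  - intros m; destruct (Hrow m) as [Em [HEm HL]].
    replace (E m) with Em by (unfold E; rewrite HL; field; exact Hwa).
    exact HEm.
  - exists (Cpow w a * S), S; split; [|split; [|reflexivity]].
    + apply (Cseries_to_ext (fun m => Cpow w a * E m)).
      * intros m; unfold E; field; exact Hwa.
      * apply Cseries_to_scal, HE.
    + apply (Cseries_to_ext (weighted_diag (expanded_term a (Lb1 k a b) (Lb2 k a b) x))).
      * intros n; symmetry; apply RHS_term_eq; assumption.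
      * exact HS.
Qed.
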